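(* There is a constant $k$, depending only on the fixed universal machine $U$, such that for all natural numbers $m,n$ with $0 \le m \le n$ there exists a binary string $x$ such that: (1) $|x| = n$; (2) $C(x) \le m + k\log n$; (3) for every compression function $q$ for length $n$ with $|q| \le m - k\log n$, we have $|q(x)| \ge n$; (4) for every compression function $q$ for length $n$ with $|q| \le m - k\log n$, we have $|q(x)| - C(x) \ge n - m - k\log n$.
   Context: All strings are over $\{0,1\}$; $\log$ is base $2$. The pairing function is $\langle x,y\rangle := 1^{|x|}0xy$. $U$ is a fixed universal Turing machine such that for every Turing machine $M$ there is a string $p$ with $M(x) = U(\langle p,x\rangle)$ for every $x$ on which $M(x)$ is defined. For a string $p$ (a ''program'') we write $p(x) := U(\langle p,x\rangle)$. The Kolmogorov complexity $C(x)$ is the length of a shortest string $p$ with $U(p) = x$. A compression function for length $n$ is a program $q$ such that $q(z)$ is defined and $U(q(z)) = z$ for all strings $z$ of length $n$. $|q|$ denotes the length of the program $q$.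
   Formalization: log n is replaced by log max(n,2): this equals log n for n ≥ 2 and 1 for n = 0, 1, since log 0 is undefined and at n = 1, m = 0 the bound C(x) ≤ 0 fails for universal machines that diverge on the empty string. *)

(* Defs.v *)
From mathcomp Require Import all_boot.
From Stdlib Require Import ZArith Reals.

Set Implicit Arguments.
Unset Strict Implicit.
Unset Printing Implicit Defensive.

Inductive symbol (G : Type) := Blank | Bit of bool | Aux of G.
Arguments Blank {G}.
Arguments Bit {G} b.
Arguments Aux {G} g.

Inductive move := MoveLeft | Stay | MoveRight.

(* Deterministic Turing machines with finitely many two-way infinite tapes,
   numbered 0, ..., tm_work.  [tm_delta] maps the current state and the scanned
   symbols to the next state and, for each tape, the symbol written and the head
   move; [None] means that the machine halts. *)
Record turing_machine := TuringMachine {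
  tm_state : finType;
  tm_aux : finType;
  tm_work : nat;
  tm_start : tm_state;
  tm_delta : tm_state -> ('I_tm_work.+1 -> symbol tm_aux) ->
             option (tm_state * ('I_tm_work.+1 -> symbol tm_aux * move))
}.

(* The content of a tape relative to its head: cell 0 is the scanned one, so
   that moving the head shifts the function. *)
Definition tape (G : Type) := Z -> symbol G.

Definition write_tape (G : Type) (a : symbol G) (t : tape G) : tape G :=
  fun z => if (z =? 0)%Z then a else t z.

Definition move_tape (G : Type) (d : move) (t : tape G) : tape G :=
  match d with
  | MoveLeft => fun z => t (z - 1)%Z
  | Stay => t
  | MoveRight => fun z => t (z + 1)%Z
  end.

Definition blank_tape (G : Type) : tape G := fun _ => Blank.

Definition input_tape (G : Type) (x : bitseq) : tape G :=
  fun z => if (z <? 0)%Z then Blank else nth Blank (map Bit x) (Z.to_nat z).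

(* [y] is the maximal block of bits that starts at the head. *)
Definition tape_output (G : Type) (t : tape G) (y : bitseq) : Prop :=
  (forall i : nat, i < size y -> t (Z.of_nat i) = Bit (nth false y i)) /\
  (forall b : bool, t (Z.of_nat (size y)) <> Bit b).

Section Semantics.

Variable M : turing_machine.

Definition config : Type :=
  tm_state M * ('I_(tm_work M).+1 -> tape (tm_aux M)).

Definition init_config (x : bitseq) : config :=
  (tm_start M, fun i => if i == ord0 then input_tape (tm_aux M) x
                        else blank_tape (tm_aux M)).

Definition step (c : config) : option config :=
  match tm_delta c.1 (fun i => c.2 i 0%Z) with
  | Some (s, act) =>
      Some (s, fun i => move_tape (act i).2 (write_tape (act i).1 (c.2 i)))
  | None => None
  end.

(* M(x) is defined and equal to y: started with x on tape 0, M halts with y on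
   tape 0. *)
Definition computes (x y : bitseq) : Prop :=
  exists (t : nat) (c : config),
    [/\ ssrnat.iter t (obind step) (Some (init_config x)) = Some c,
        step c = None
      & tape_output (c.2 ord0) y].

End Semantics.

Definition pairing (x y : bitseq) : bitseq :=
  nseq (size x) true ++ false :: x ++ y.

Definition universal (U : turing_machine) : Prop :=
  forall M : turing_machine, exists p : bitseq,
    forall x y : bitseq, computes M x y -> computes U (pairing p x) y.

(* p(x) = y *)
Definition prog_computes (U : turing_machine) (p x y : bitseq) : Prop :=
  computes U (pairing p x) y.

(* C(x) = c; for universal U such a (unique) c exists for every x. *)
Definition kolmogorov (U : turing_machine) (x : bitseq) (c : nat) : Prop :=
  (exists2 p : bitseq, computes U p x & size p = c) /\
  (forall p : bitseq, computes U p x -> c <= size p).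

Definition compression_function (U : turing_machine) (n : nat) (q : bitseq) :
    Prop :=
  forall z : bitseq, size z = n ->
    exists2 y : bitseq, prog_computes U q z y & computes U y z.

Definition log2 (n : nat) : R := (ln (INR n) / ln 2)%R.

(* Main.v *)
From HB Require Import structures.
Require Import Defs.
From mathcomp Require Import all_boot zify_ssreflect.
From Stdlib Require Import ZArith Reals Lia Lra Classical.
From Stdlib Require Import FunctionalExtensionality.

(* Among the compression functions for length [n] of length at most
   [m - k log n], let [q] be one whose slowest decompression [U(q(z)) = z] takes
   the longest, and let [t] bound the time of all its decompressions.  There are
   fewer strings [y] shorter than [n] than strings of length [n], so some [x] of
   length [n] is not output by [U] within [t] steps on any such [y].  If a
   compression function [q'] in the family had [|q'(x)| < n], then [U] would
   output [x] on [q'(x)] within [t] steps, by the choice of [q]; so [|q'(x)| >= n].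
   Finally [x] can be computed from [n] and [q]: run [q] and [U] on all strings of
   length [n] to find [t], then search for [x].  Hence
   [C(x) <= |q| + O(log n) <= m + O(log n)].

   The machine that does this is a while program on finitely many stacks, where a
   stack is the part of a tape from the head rightwards, so that inputs and
   outputs are stacks of bits as they stand.  It contains the transition table
   of [U], and holds each tape of [U] in two stacks. *)

Set Implicit Arguments.
Unset Strict Implicit.
Unset Printing Implicit Defensive.

(* [Reals] rebinds both of these. *)
Local Notation "m ^ n" := (expn m n) : nat_scope.
Local Notation id := Datatypes.id.

(** * Stack programs and their compilation *)

Section StackPrograms.

Variables V A : finType.

Definition letter := (bool + A)%type.
(** [None] is the stack that holds the input and, at the end, the output; it becomes tape 0. *)
Definition stack_var := option V.
Definition store := stack_var -> seq letter.
Definition view := stack_var -> option letter.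

Definition top (s : store) : view := fun v => ohead (s v).

(* An action pops every stack and pushes at most two letters back. *)
Definition action := view -> stack_var -> seq letter.

Definition act (f : action) (s : store) : store :=
  fun v => take 2 (f (top s) v) ++ behead (s v).

Definition keep (t : view) (v : stack_var) : seq letter :=
  if t v is Some a then [:: a] else [::].

Inductive cmd :=
  | Act of action
  | Seq of cmd & cmd
  | If of (view -> bool) & cmd & cmd
  | While of (view -> bool) & cmd.

Inductive run : cmd -> store -> store -> Prop :=
  | RunAct f s : run (Act f) s (act f s)
  | RunSeq c d s s' s'' : run c s s' -> run d s' s'' -> run (Seq c d) s s''
  | RunIf b c d s s' :
      run (if b (top s) then c else d) s s' -> run (If b c d) s s'
  | RunWhileF (b : view -> bool) c s : ~~ b (top s) -> run (While b c) s s
  | RunWhileT (b : view -> bool) c s s' s'' : b (top s) -> run c s s' ->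
      run (While b c) s' s'' -> run (While b c) s s''.

(** Control points of a command, later part of the finite state set of a machine. The extra point
    [None] of [If] and [While] is where the test is made. *)
Fixpoint label (c : cmd) : finType :=
  match c with
  | Act _ => unit
  | Seq c d => (label c + label d)%type
  | If _ c d => option (label c + label d)
  | While _ c => option (label c)
  end.

Fixpoint entry (c : cmd) : label c :=
  match c with
  | Act _ => tt
  | Seq c d => inl (entry c)
  | If _ c d => None
  | While _ c => None
  end.

(* The next label is [None] when the command terminates. *)
Fixpoint trans (c : cmd) :
    label c -> view -> option (label c) * (stack_var -> seq letter) :=
  match c return label c -> view -> option (label c) * (stack_var -> seq letter) with
  | Act f => fun _ t => (None, f t)
  | Seq c d => fun l t =>
      match l with
      | inl l => let: (o, w) := trans l t in
                 (Some (if o is Some l' then inl l' else inr (entry d)), w)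
      | inr l => let: (o, w) := trans l t in (omap inr o, w)
      end
  | If b c d => fun l t =>
      match l with
      | None => (Some (Some (if b t then inl (entry c) else inr (entry d))),
                 keep t)
      | Some (inl l) =>
          let: (o, w) := trans l t in (omap (Some \o inl) o, w)
      | Some (inr l) =>
          let: (o, w) := trans l t in (omap (Some \o inr) o, w)
      end
  | While b c => fun l t =>
      match l with
      | None => (if b t then Some (Some (entry c)) else None, keep t)
      | Some l => let: (o, w) := trans l t in (Some o, w)
      end
  end.

Definition next c (l : label c) (s : store) : option (label c) * store :=
  ((trans l (top s)).1, act (fun t => (trans l t).2) s).

Inductive reach c : option (label c) -> store -> option (label c) -> store ->
    Prop :=
  | Reach0 o s : reach o s o s
  | ReachS l s o' s' :
      reach (next l s).1 (next l s).2 o' s' -> reach (Some l) s o' s'.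

Lemma reach_trans c (o1 o2 o3 : option (label c)) s1 s2 s3 :
  reach o1 s1 o2 s2 -> reach o2 s2 o3 s3 -> reach o1 s1 o3 s3.
Proof. by elim=> // l s o' s' _ IH /IH; apply: ReachS. Qed.

(** Executions of a subcommand become executions of the whole command; [L] also says where control
    goes when the subcommand ends. *)
Lemma reach_lift c d (L : option (label c) -> option (label d)) :
  (forall l, exists2 l', L (Some l) = Some l' &
     forall s, next l' s = (L (next l s).1, (next l s).2)) ->
  forall o s o' s', reach o s o' s' -> reach (L o) s (L o') s'.
Proof.
move=> HL o s o' s'; elim=> [*|l {}s {}o' {}s' _ IH]; first exact: Reach0.
have [l' -> Hl'] := HL l; apply: ReachS.
by rewrite Hl'.
Qed.

Lemma act_keep s : act keep s = s.
Proof.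
apply: functional_extensionality => v.
by rewrite /act /keep /top; case: (s v).
Qed.

Lemma run_reach c s s' : run c s s' -> reach (Some (entry c)) s None s'.
Proof.
elim=> {c s s'}.
- by move=> f s; apply/ReachS/Reach0.
- move=> c d s s' s'' _ IHc _ IHd.
  (* The end of [c] is identified with the entry of [d]. *)
  pose Lc (o : option (label c)) : option (label (Seq c d)) :=
    Some (if o is Some l then inl l else inr (entry d)).
  have HL : forall l, exists2 l', Lc (Some l) = Some l' &
     forall s, next l' s = (Lc (next l s).1, (next l s).2).
    move=> l; exists (inl l) => // r; rewrite /next /Lc /=.
    case E: (trans l (top r)) => [o w] /=; congr (_, _).
    by apply: functional_extensionality => v; rewrite /act E.
  apply: (reach_trans (reach_lift HL IHc)).
  apply: (@reach_lift d (Seq c d) (omap inr) _ _ _ _ _ IHd) => l.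
  exists (inr l) => // r; rewrite /next /=.
  case E: (trans l (top r)) => [o w] /=; congr (_, _).
  by apply: functional_extensionality => v; rewrite /act E.
- move=> b c d s s' _ IH; apply: ReachS; rewrite /next /=.
  rewrite -/keep [act _ s]act_keep; case: (b (top s)) IH => IH.
    apply: (@reach_lift c (If b c d) (omap (Some \o inl)) _ _ _ _ _ IH) => l.
    exists (Some (inl l)) => // r; rewrite /next /=.
    case E: (trans l (top r)) => [o w] /=; congr (_, _).
    by apply: functional_extensionality => v; rewrite /act E.
  apply: (@reach_lift d (If b c d) (omap (Some \o inr)) _ _ _ _ _ IH) => l.
  exists (Some (inr l)) => // r; rewrite /next /=.
  case E: (trans l (top r)) => [o w] /=; congr (_, _).
  by apply: functional_extensionality => v; rewrite /act E.
- move=> b c s /negbTE bF; apply: ReachS; rewrite /next /= bF [act _ s]act_keep.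
  exact: Reach0.
- move=> b c s s' s'' bT _ IHc _ IHw; apply: ReachS.
  rewrite /next /= bT [act _ s]act_keep; apply: reach_trans IHw.
  (* The end of the body, [None], is sent to [Some None], where the test is made again. *)
  apply: (@reach_lift c (While b c) Some _ _ _ _ _ IHc) => l.
  exists (Some l) => // r; rewrite /next /=.
  case E: (trans l (top r)) => [o w] /=; congr (_, _).
  by apply: functional_extensionality => v; rewrite /act E.
Qed.

(** * Stacks as tapes of a Turing machine *)

Definition cell (a : letter) : symbol A :=
  match a with inl b => Bit b | inr g => Aux g end.

Definition uncell (a : symbol A) : option letter :=
  match a with Blank => None | Bit b => Some (inl b) | Aux g => Some (inr g) end.

Definition stack_tape (l : seq letter) : tape A :=
  fun z => if (z <? 0)%Z then Blank else nth Blank (map cell l) (Z.to_nat z).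

Definition var_of (i : 'I_#|V|.+1) : stack_var := omap enum_val (unlift ord0 i).

Definition tape_of (v : stack_var) : 'I_#|V|.+1 :=
  if v is Some x then lift ord0 (enum_rank x) else ord0.

Lemma tape_ofK : cancel tape_of var_of.
Proof.
case=> [v|]; rewrite /var_of /tape_of ?unlift_none // liftK /= enum_rankK //.
Qed.

(** A pop blanks the cell before moving right, so that all cells left of the head stay blank. Two
    letters put back need one new cell, which is the blank one to the left. *)
Definition write_low (l : seq letter) : symbol A * move :=
  match l with
  | [::] => (Blank, MoveRight)
  | [:: a] => (cell a, Stay)
  | _ :: a :: _ => (cell a, MoveLeft)
  end.

Definition write_high (l : seq letter) : option letter :=
  if l is [:: a, _ & _] then Some a else None.

(* A head move comes after the write, so an action takes two machine steps: the
   first writes the lower letter and moves, the second writes the letters that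
   have become the tops; these are remembered in the state. *)
Definition stack_delta c
    (q : (option (label c) + option (label c) * {ffun stack_var -> option letter})%type)
    (a : 'I_#|V|.+1 -> symbol A) :=
  match q with
  | inl None => None
  | inl (Some l) =>
      let: (o, w) := trans l (fun v => uncell (a (tape_of v))) in
      Some (inr (o, [ffun v => write_high (take 2 (w v))]),
            fun i => write_low (take 2 (w (var_of i))))
  | inr (o, p) =>
      Some (inl o, fun i =>
        (if p (var_of i) is Some x then cell x else a i, Stay))
  end.

Definition stack_machine c : turing_machine :=
  @TuringMachine _ A #|V| (inl (Some (entry c))) (@stack_delta c).

Definition stack_config c (o : option (label c)) (s : store) :
    config (stack_machine c) := (inl o, fun i => stack_tape (s (var_of i))).

Lemma uncell_stack_tape l : uncell (stack_tape l 0%Z) = ohead l.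
Proof. by case: l => [|[] ]. Qed.

Lemma stack_tape_eq l t : (forall z, (z < 0)%Z -> t z = Blank) ->
  (forall i, t (Z.of_nat i) = nth Blank (map cell l) i) -> t = stack_tape l.
Proof.
move=> t0 t1; apply: functional_extensionality => z; rewrite /stack_tape.
case: Z.ltb_spec => [|z0]; first exact: t0.
by rewrite -t1 Z2Nat.id.
Qed.

Lemma stack_tape_of_nat l i :
  stack_tape l (Z.of_nat i) = nth Blank (map cell l) i.
Proof.
rewrite /stack_tape; case: Z.ltb_spec; first by Lia.lia.
by rewrite Nat2Z.id.
Qed.

Lemma stack_tape_neg l z : (z < 0)%Z -> stack_tape l z = Blank.
Proof. by rewrite /stack_tape; case: Z.ltb_spec => //; Lia.lia. Qed.

(** The two machine steps of an action, seen on one tape. The tapes agree cell by cell in each of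
    the cases of zero, one and at least two letters in [w]. *)
Lemma stack_tape_action l w :
  let t := move_tape (write_low (take 2 w)).2
             (write_tape (write_low (take 2 w)).1 (stack_tape l)) in
  move_tape Stay (write_tape
    (if write_high (take 2 w) is Some x then cell x else t 0%Z) t) =
  stack_tape (take 2 w ++ behead l).
Proof.
case: w => [|a [|b w]]; apply: stack_tape_eq => /= [z z0|i];
  rewrite /write_tape ?take0 /=.
- case: Z.eqb_spec; first by Lia.lia.
  by case: Z.eqb_spec => //= *; apply: stack_tape_neg; Lia.lia.
- case: i => [|i]; first by rewrite /= (stack_tape_of_nat l 1); case: l.
  have -> : (Z.of_nat i.+1 + 1 = Z.of_nat i.+2)%Z by Lia.lia.
  rewrite stack_tape_of_nat /=; by case: l => [|? l] //=; rewrite nth_nil.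
- case: Z.eqb_spec; first by Lia.lia.
  by move=> _; apply: stack_tape_neg.
- case: i => [|i] //=; rewrite (stack_tape_of_nat l i.+1).
  by case: l => [|? l] //=; rewrite nth_nil.
- case: Z.eqb_spec; first by Lia.lia.
  case: Z.eqb_spec; first by Lia.lia.
  by move=> _ _; apply: stack_tape_neg; Lia.lia.
- case: i => [|[|i]] //.
  case: Z.eqb_spec; first by Lia.lia.
  case: Z.eqb_spec; first by Lia.lia.
  have -> : (Z.of_nat i.+2 - 1 = Z.of_nat i.+1)%Z by Lia.lia.
  by rewrite stack_tape_of_nat; case: l => [|? l] //=; rewrite nth_nil.
Qed.

Lemma stack_machine_next c (l : label c) s :
  obind (@step _) (step (stack_config (Some l) s)) =
  Some (stack_config (next l s).1 (next l s).2).
Proof.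
rewrite /step /= /stack_delta /=.
have -> : (fun v => uncell (stack_tape (s (var_of (tape_of v))) 0%Z)) = top s.
  apply: functional_extensionality => v.
  by rewrite tape_ofK uncell_stack_tape.
rewrite /next; case E: (trans l (top s)) => [o w] /=.
congr (Some (_, _)); apply: functional_extensionality => i.
by rewrite ffunE /act E; apply: stack_tape_action.
Qed.

Lemma reach_machine c (o o' : option (label c)) s s' : reach o s o' s' ->
  exists t, ssrnat.iter t (obind (@step _)) (Some (stack_config o s)) =
    Some (stack_config o' s').
Proof.
elim=> [{}o {}s|l {}s {}o' {}s' _ [t IH]]; first by exists 0.
by exists (t + 2); rewrite iterD /= stack_machine_next.
Qed.

Definition input_store (x : bitseq) : store :=
  fun v => if v is None then map inl x else [::].

Lemma run_computes c x y s : run c (input_store x) s ->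
  s None = map inl y -> computes (stack_machine c) x y.
Proof.
move=> /run_reach /reach_machine [t Ht] Hy.
exists t, (stack_config None s); split=> //.
  rewrite -Ht; congr (ssrnat.iter _ _ (Some (_, _))).
  apply: functional_extensionality => i; rewrite /var_of.
  case: unliftP => [j|] -> /=.
    apply: functional_extensionality => z; rewrite /stack_tape /blank_tape.
    by case: (z <? 0)%Z; rewrite //= nth_nil.
  rewrite /input_tape /stack_tape -map_comp //.
rewrite /= /var_of unlift_none /= Hy; split=> [i Hi|b].
  rewrite stack_tape_of_nat -map_comp (nth_map false) //.
by rewrite stack_tape_of_nat nth_default ?size_map.
Qed.

End StackPrograms.

(** * Enumeration of bit strings *)

(* Bit strings are enumerated by length, least significant bit first; [rank] is
   the position in this enumeration. *)
Fixpoint succ (y : bitseq) : bitseq :=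
  match y with
  | [::] => [:: false]
  | false :: y => true :: y
  | true :: y => false :: succ y
  end.

Fixpoint rank (y : bitseq) : nat :=
  if y is b :: y then (rank y).*2 + b.+1 else 0.

Lemma rank_succ y : rank (succ y) = (rank y).+1.
Proof. by elim: y => [|[] y IH] //=; lia. Qed.

Lemma rank_inj : injective rank.
Proof.
elim=> [|a x IH] [|b y] //=; [lia | lia | case: a; case: b => E].
- by congr cons; apply: IH; lia.
- lia.
- lia.
- by congr cons; apply: IH; lia.
Qed.

Lemma rank_onto k : exists y, rank y = k.
Proof.
by elim: k => [|k [y Hy]]; [exists [::] | exists (succ y); rewrite rank_succ Hy].
Qed.

(** There are 2^n - 1 strings shorter than n, so those of length n have the ranks from 2^n - 1 to
    2^(n+1) - 2. *)
Lemma rank_bounds y : 2 ^ size y <= (rank y).+1 < 2 ^ (size y).+1.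
Proof. by elim: y => [|b y] //=; rewrite !expnS; case: b => /=; lia. Qed.

Lemma size_succ y : size (succ y) = size y + all id y.
Proof. by elim: y => [|[] y IH] //=; rewrite ?IH; lia. Qed.

Lemma rank_lt_size y n : (rank y).+1 < 2 ^ n -> size y < n.
Proof.
move=> H; have /andP[/leq_ltn_trans /(_ H)] := rank_bounds y.
by rewrite ltn_exp2l.
Qed.

Lemma size_lt_rank x y : size x < size y -> rank x < rank y.
Proof.
move=> H; have /andP[_ Hx] := rank_bounds x; have /andP[Hy _] := rank_bounds y.
have : 2 ^ (size x).+1 <= 2 ^ size y by rewrite leq_exp2l.
lia.
Qed.

(** The form in which [inc] carries out [succ]: the carry turns a leading run of ones into zeros and
    stops at the first zero, or appends a zero when no letter is left. *)
Lemma succ_split y : exists k r,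
  [/\ y = nseq k true ++ r, ohead r <> Some true,
      succ y = nseq k false ++ (r != [::]) :: behead r & all id y = (r == [::])].
Proof.
elim: y => [|[] y [k [r [E1 E2 E3 E4]]]]; first by exists 0, [::].
  by exists k.+1, r; split=> //=; rewrite ?E1 -?E1 ?E3.
by exists 0, (false :: y).
Qed.

(** * Basic routines *)

Notation "c ;; d" := (Seq c d) (at level 61, right associativity).

Section Routines.

Variables V A : finType.
Notation letter := (letter A).
Notation var := (stack_var V).
Notation store := (store V A).
Implicit Types (s : store) (v X T C : var).

Lemma run_eq (c : cmd V A) s s' s'' : run c s s' -> s' =1 s'' -> run c s s''.
Proof. by move=> H /functional_extensionality <-. Qed.

Lemma act_keep_at s v : take 2 (keep (top s) v) ++ behead (s v) = s v.
Proof. by rewrite /keep /top; case: (s v). Qed.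

(** Total correctness of a loop: the index of the invariant is a variant that drops in every round,
    which yields termination. *)
Lemma run_while_inv (I : nat -> store -> Prop) (b : view V A -> bool)
    (c : cmd V A) :
  (forall k s, I k s -> b (top s) ->
     exists s' j, [/\ run c s s', I j s' & j < k]) ->
  forall k s, I k s ->
    exists s' j, [/\ run (While b c) s s', I j s' & ~~ b (top s')].
Proof.
move=> H k; have [m] := ubnP k; elim: m k => // m IH k Hk s Is.
case E: (b (top s)); last first.
  by exists s, k; split; rewrite ?E //; apply: RunWhileF; rewrite E.
have [s' [j [R Is' Hj]]] := H _ _ Is E.
have [|s'' [i [R' Is'' Hb]]] := IH j _ s' Is'; first by lia.
by exists s'', i; split=> //; apply: RunWhileT R R'.
Qed.

Definition opt_seq (o : option letter) : seq letter :=
  if o is Some a then [:: a] else [::].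

(** The loop behind all transfers between stacks; [f] allows several targets and a recoding for
    each. The order of the letters is reversed. *)
Definition moveW X (p : pred letter) (f : letter -> var -> option letter) :=
  While (fun t => oapp p false (t X))
    (Act (fun t v => if v == X then [::]
                     else opt_seq (obind (f^~ v) (t X)) ++ keep t v)).

Definition pushes (f : letter -> var -> option letter) v (l : seq letter) :=
  pmap (f^~ v) l.

Lemma run_moveW X p f s l r :
  s X = l ++ r -> all p l -> ~~ oapp p false (ohead r) ->
  run (moveW X p f) s
    (fun v => if v == X then r else pushes f v (rev l) ++ s v).
Proof.
elim: l s => [|a l IH] s /= E.
  move=> _ Hr; apply: run_eq; first by apply: RunWhileF; rewrite /top E.
  by move=> v; case: eqP => [->|].
case/andP=> pa pl Hr; apply: RunWhileT; [by rewrite /top E | exact: RunAct | ].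
apply: run_eq; first by apply: IH Hr => //; rewrite /act eqxx /top E.
move=> v /=; case: eqP => // vX; rewrite /pushes rev_cons -cats1 pmap_cat -catA.
congr cat; rewrite /act /top E; case: eqP vX => //= _ _.
by rewrite /keep; case: (f a v) => [c|]; case: (s v).
Qed.

Definition dest (vs : seq var) (a : letter) v : option letter :=
  if v \in vs then Some a else None.

Lemma pushes_some (g : letter -> letter) f v l :
  (forall a, f a v = Some (g a)) -> pushes f v l = map g l.
Proof. by move=> H; elim: l => //= a l IH; rewrite /pushes /= H /= -IH. Qed.

Lemma pushes_none f v l : (forall a, f a v = None) -> pushes f v l = [::].
Proof. by move=> H; elim: l => //= a l IH; rewrite /pushes /= H /= -IH. Qed.

Definition move X f := moveW X predT f.

Lemma run_move X f s :
  run (move X f) s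
    (fun v => if v == X then [::] else pushes f v (rev (s X)) ++ s v).
Proof. by apply: run_moveW; rewrite ?cats0 //; apply/allP. Qed.

(** The passage through [T] reverses the letters and the way back reverses them again, so [X] is
    restored and the targets receive the letters in its order. *)
Definition copy X T f :=
  move X (fun a v => if v == T then Some a else None) ;;
  move T (fun a v => if v == X then Some a else f a v).

Lemma run_copy X T f s : s T = [::] -> X != T ->
  run (copy X T f) s
    (fun v => if (v == X) || (v == T) then s v else pushes f v (s X) ++ s v).
Proof.
move=> sT nXT; apply: RunSeq; first exact: run_move.
apply: run_eq; first exact: run_move.
move=> v /=; rewrite (eq_sym T X) (negbTE nXT).
rewrite [pushes _ T _](@pushes_some id) => [|a]; last by rewrite eqxx.
rewrite map_id sT cats0 revK.
case: (v =P T) => [->|/eqP nvT]; first by rewrite orbT.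
rewrite orbF; case: (v =P X) => [->|/eqP nvX].
  by rewrite (@pushes_some id) ?map_id ?cats0 // => a; rewrite eqxx.
rewrite [X in _ ++ X]/=; congr cat.
  rewrite /pushes; apply: eq_pmap => a /=; by rewrite (negbTE nvX).
by rewrite pushes_none // => a; rewrite (negbTE nvT).
Qed.

(** The carry leaves the string exactly when its length grows; [C] then loses a mark, and so counts
    the lengths still to come. *)
Definition inc X C T :=
  moveW X (pred1 (inl true)) (fun _ v => if v == T then Some (inl false) else None) ;;
  Act (fun t v => if v == X then [:: inl (t X != None)]
                  else if (v == C) && (t X == None) then [::] else keep t v) ;;
  move T (dest [:: X]).

Lemma run_inc X C T s y : s X = map inl y -> s T = [::] ->
  X != T -> C != X -> C != T ->
  run (inc X C T) s (fun v => if v == X then map inl (succ y)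
    else if (v == C) && all id y then behead (s v) else s v).
Proof.
move=> sX sT nXT nCX nCT; have [k [r [Ey Er Es Ea]]] := succ_split y.
pose s1 : store := fun v => if v == X then map inl r
  else if v == T then nseq k (inl false) else s v.
have R1 : run (moveW X (pred1 (inl true))
    (fun _ v => if v == T then Some (inl false) else None)) s s1.
  apply: run_eq.
    apply: (@run_moveW _ _ _ _ (nseq k (inl true)) (map inl r)).
    - by rewrite sX Ey map_cat map_nseq.
    - by rewrite all_nseq /= eqxx orbT.
    - by move: Er; case: (r) => [|[]].
  move=> v; rewrite /s1; case: eqP => // _; case: eqP => [->|/eqP nvT].
    by rewrite (@pushes_some (fun=> inl false)) ?eqxx // sT cats0 rev_nseq map_nseq.
  by rewrite pushes_none // => a; rewrite (negbTE nvT).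
apply: RunSeq R1 _; apply: RunSeq; first exact: RunAct.
apply: run_eq; first exact: run_move.
move=> v; case: (v =P T) => [->|/eqP nvT].
  by rewrite eq_sym (negbTE nXT) eq_sym (negbTE nCT) sT.
rewrite [act _ _ T]/act [T == X]eq_sym (negbTE nXT) [T == C]eq_sym (negbTE nCT).
rewrite act_keep_at /s1 eq_sym (negbTE nXT) eqxx -/s1.
have tX : (top s1 X == None) = (r == [::]).
  by rewrite /top /s1 eqxx; case: (r).
case: (v =P X) => [->|/eqP nvX].
  rewrite (@pushes_some id) => [|a]; last by rewrite /dest inE eqxx.
  rewrite map_id rev_nseq Es map_cat map_nseq; congr cat.
  rewrite /act eqxx tX /= /s1 eqxx; congr cons.
  by case: (r).
rewrite pushes_none => [|a]; last by rewrite /dest inE (negbTE nvX).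
rewrite /act (negbTE nvX) tX Ea /=.
have s1v : s1 v = s v by rewrite /s1 (negbTE nvX) (negbTE nvT).
by case: ifP => _; rewrite ?act_keep_at ?s1v.
Qed.

End Routines.

(** * Running the universal machine *)

(* P: the prefix [pairing q [::]]; N: [n] in unary; Z: candidate for [x];
   Y: string of the current enumeration; C: number of lengths left in that
   enumeration, in unary; T: the time bound in unary; D: what is left of it in a
   bounded run; A, B: scratch; S: the state of U. *)
Inductive reg := regP | regN | regZ | regY | regC | regT | regD | regA | regB | regS.

Definition reg_code (r : reg) : 'I_10 :=
  inord match r with
  | regP => 0 | regN => 1 | regZ => 2 | regY => 3 | regC => 4
  | regT => 5 | regD => 6 | regA => 7 | regB => 8 | regS => 9
  end.

Definition reg_decode (i : 'I_10) : reg :=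
  nth regP [:: regP; regN; regZ; regY; regC; regT; regD; regA; regB; regS] i.

Lemma reg_codeK : cancel reg_code reg_decode.
Proof. by case; rewrite /reg_code /reg_decode inordK. Qed.

Definition reg_eq (r r' : reg) : bool :=
  match r, r' with
  | regP, regP | regN, regN | regZ, regZ | regY, regY | regC, regC
  | regT, regT | regD, regD | regA, regA | regB, regB | regS, regS => true
  | _, _ => false
  end.

Lemma reg_eqP : Equality.axiom reg_eq.
Proof. by case; case; constructor. Qed.

HB.instance Definition _ := hasDecEq.Build reg reg_eqP.
HB.instance Definition _ := Countable.copy reg (can_type reg_codeK).
HB.instance Definition _ : isFinite reg := CanIsFinite reg_codeK.

Section UniversalRun.

Variable U : turing_machine.

Notation V := (reg + bool * 'I_(tm_work U).+1)%type.
Notation A := (option (tm_aux U) + tm_state U)%type.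
Notation letter := (letter A).
Notation var := (stack_var V).
Notation store := (store V A).
Notation view := (view V A).

Definition vIn : var := None.
Definition vr (r : reg) : var := Some (inl r).
Definition vL i : var := Some (inr (false, i)).
Definition vR i : var := Some (inr (true, i)).
Notation vR0 := (vR ord0).
Coercion vr : reg >-> stack_var.


Lemma var_eqE :
  (forall r r', (vr r == vr r') = reg_eq r r') *
  (forall r, (vr r == vIn) = false) * (forall r, (vIn == vr r) = false) *
  (forall r i, (vr r == vR i) = false) * (forall r i, (vr r == vL i) = false) *
  (forall r i, (vR i == vr r) = false) * (forall r i, (vL i == vr r) = false) *
  (forall i, (vR i == vIn) = false) * (forall i, (vL i == vIn) = false) *
  (forall i, (vIn == vR i) = false) * (forall i, (vIn == vL i) = false) *
  (forall i j, (vL i == vR j) = false) * (forall i j, (vR i == vL j) = false) *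
  (forall i j, (vR i == vR j) = (i == j)).
Proof. by []. Qed.

(** A blank of [U] gets a letter of its own, since it may lie between other symbols within a
    stack. *)
Definition enc (a : symbol (tm_aux U)) : letter :=
  match a with
  | Blank => inr (inl None)
  | Bit b => inl b
  | Aux g => inr (inl (Some g))
  end.

Definition dec (a : letter) : symbol (tm_aux U) :=
  match a with
  | inl b => Bit b
  | inr (inl (Some g)) => Aux g
  | inr _ => Blank
  end.

Lemma encK : cancel enc dec. Proof. by case. Qed.

Definition mark : letter := inl true.

(* [l], read from the top, is the part of the tape to the left of the head, and
   [r] starts at the scanned cell; cells beyond either stack are blank. *)
Definition zipper (l r : seq letter) : tape (tm_aux U) :=
  fun z => if (z <? 0)%Z then nth Blank (map dec l) (Z.to_nat (- z - 1))
           else nth Blank (map dec r) (Z.to_nat z).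

Definition represents (s : store) (c : config U) : Prop :=
  s regS = [:: inr (inr c.1)] /\ c.2 = fun i => zipper (s (vL i)) (s (vR i)).

Definition scan (t : view) (i : 'I_(tm_work U).+1) : symbol (tm_aux U) :=
  oapp dec Blank (t (vR i)).

Definition udelta (t : view) :=
  if t regS is Some (inr (inr q)) then tm_delta q (scan t) else None.

(** A step of [U] puts at most two letters back on any stack, so one action suffices; [g] lets a
    clock run along. A left move from an empty left stack brings in a blank. *)
Definition ustep (g : view -> reg -> seq letter) : action V A := fun t v =>
  if udelta t is Some (q, a) then
    match v with
    | Some (inl regS) => [:: inr (inr q)]
    | Some (inl r) => g t r
    | None => keep t v
    | Some (inr (true, i)) =>
        match (a i).2 with
        | MoveLeft => [:: odflt (enc Blank) (t (vL i)); enc (a i).1]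
        | Stay => [:: enc (a i).1]
        | MoveRight => [::]
        end
    | Some (inr (false, i)) =>
        match (a i).2 with
        | MoveLeft => [::]
        | Stay => keep t v
        | MoveRight => enc (a i).1 :: keep t v
        end
    end
  else keep t v.

Lemma represents_udelta s c : represents s c ->
  udelta (top s) = tm_delta c.1 (fun i => c.2 i 0%Z).
Proof.
case=> sS ->; rewrite /udelta /top sS /=; congr tm_delta.
apply: functional_extensionality => i; rewrite /scan /zipper /=.
by case: (s (vR i)).
Qed.

Lemma zipperP (t : tape (tm_aux U)) l r :
  (forall i : nat, t (Z.of_nat i) = nth Blank (map dec r) i) ->
  (forall i : nat, t (- Z.of_nat i - 1)%Z = nth Blank (map dec l) i) ->
  t = zipper l r.
Proof.
move=> Hr Hl; apply: functional_extensionality => z; rewrite /zipper.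
case: Z.ltb_spec => Hz; last by rewrite -Hr Z2Nat.id.
rewrite -Hl; congr t; lia.
Qed.

Lemma zipper_ge0 l r (i : nat) :
  zipper l r (Z.of_nat i) = nth Blank (map dec r) i.
Proof. by rewrite /zipper; case: Z.ltb_spec; [lia | rewrite Nat2Z.id]. Qed.

Lemma zipper_lt0 l r (i : nat) :
  zipper l r (- Z.of_nat i - 1)%Z = nth Blank (map dec l) i.
Proof.
rewrite /zipper; case: Z.ltb_spec; last lia.
by move=> _; congr nth; lia.
Qed.

Lemma write_zipper a l r :
  write_tape a (zipper l r) = zipper l (enc a :: behead r).
Proof.
apply: zipperP => i; rewrite /write_tape; case: Z.eqb_spec => Hi; try lia.
- have {Hi} -> : i = 0 by lia.
  by rewrite /= encK.
- rewrite zipper_ge0; case: i Hi => [|i] //= _.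
  by case: r => [|? r] //=; rewrite nth_nil.
- by rewrite zipper_lt0.
Qed.

Lemma move_left_zipper l r a :
  move_tape MoveLeft (zipper l (enc a :: r)) =
  zipper (behead l) [:: odflt (enc Blank) (ohead l), enc a & r].
Proof.
apply: zipperP => i /=.
- case: i => [|i]; last first.
    have -> : (Z.of_nat i.+1 - 1 = Z.of_nat i)%Z by lia.
    by rewrite zipper_ge0.
  by rewrite (zipper_lt0 l _ 0); case: l.
- have -> : (- Z.of_nat i - 1 - 1 = - Z.of_nat i.+1 - 1)%Z by lia.
  by rewrite zipper_lt0; case: l => [|? l] //=; rewrite nth_nil.
Qed.

Lemma move_right_zipper l r a :
  move_tape MoveRight (zipper l (enc a :: r)) = zipper (enc a :: l) r.
Proof.
apply: zipperP => i /=.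
  have -> : (Z.of_nat i + 1 = Z.of_nat i.+1)%Z by lia.
  by rewrite zipper_ge0.
case: i => [|i]; first by rewrite (zipper_ge0 l _ 0).
have -> : (- Z.of_nat i.+1 - 1 + 1 = - Z.of_nat i - 1)%Z by lia.
by rewrite zipper_lt0.
Qed.

Lemma represents_ustep g s c c' : represents s c -> step c = Some c' ->
  [/\ represents (act (ustep g) s) c', act (ustep g) s vIn = s vIn
    & forall r, r != regS ->
        act (ustep g) s r = take 2 (g (top s) r) ++ behead (s r)].
Proof.
move=> Hrep; have Hd := represents_udelta Hrep; case: Hrep => sS sT.
rewrite /step -Hd; case E: (udelta (top s)) => [[q a]|] // [<-].
have actE v : act (ustep g) s v = take 2 (ustep g (top s) v) ++ behead (s v) by [].
split; last by case=> // _; rewrite actE /ustep E.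
- split=> /=; first by rewrite actE /ustep E sS.
  apply: functional_extensionality => i; rewrite sT write_zipper !actE /ustep E.
  case Em: (a i).2.
  + by rewrite move_left_zipper /= Em /top.
  + by rewrite /= Em act_keep_at.
  + by rewrite move_right_zipper /= Em /top /keep; case: (s (vL i)).
- by rewrite actE /ustep E act_keep_at.
Qed.

Lemma push_keep a (s : store) v :
  take 2 (a :: keep (top s) v) ++ behead (s v) = a :: s v.
Proof. by rewrite /keep /top; case: (s v). Qed.

Lemma isSome_udelta s c : represents s c ->
  isSome (udelta (top s)) = isSome (step c).
Proof.
move=> /represents_udelta ->; rewrite /step.
by case: tm_delta => [[]|].
Qed.

(** * Timed and time-bounded runs of [U] *)

Definition clocked : cmd V A :=
  While (fun t => isSome (udelta t)) (Act (ustep (fun t r =>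
    if r == regT then mark :: keep t r else keep t r))).

(** Each step consumes a mark of [regD], so this loop ends even where [U] does not halt. *)
Definition budgeted : cmd V A :=
  While (fun t => isSome (udelta t) && isSome (t regD)) (Act (ustep (fun t r =>
    if r == regD then [::] else keep t r))).

Notation usteps k c := (ssrnat.iter k (obind (@step U)) (Some c)).

Lemma usteps_None k : ssrnat.iter k (obind (@step U)) None = None.
Proof. by elim: k => //= k ->. Qed.

Lemma run_clocked k s c c' :
  represents s c -> usteps k c = Some c' -> step c' = None ->
  exists s', [/\ run clocked s s', represents s' c', s' vIn = s vIn
    & forall r, r != regS ->
        s' r = if r == regT then nseq k mark ++ s r else s r].
Proof.
elim: k s c => [|k IH] s c Hs.
  case=> <- Hc; exists s; split=> // [|r _]; last by rewrite if_same.
  by apply: RunWhileF; rewrite (isSome_udelta Hs) Hc.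
rewrite iterSr /=; case E: (step c) => [c1|]; last by rewrite usteps_None.
have [Hs1 In1 F1] := represents_ustep (fun t r =>
    if r == regT then mark :: keep t r else keep t r) Hs E.
move=> Hk Hc; have [s' [R Hs' In' F']] := IH _ _ Hs1 Hk Hc.
exists s'; split=> // [||r Hr].
- by apply: RunWhileT R; [rewrite (isSome_udelta Hs) E | exact: RunAct].
- by rewrite In'.
rewrite F' // F1 //; case: (r == regT); last exact: act_keep_at.
by rewrite push_keep -[mark :: s r]/(nseq 1 mark ++ s r) catA -nseqD addn1.
Qed.

Lemma run_budgeted k s c : represents s c -> s regD = nseq k mark ->
  exists s' j c', [/\ run budgeted s s', represents s' c', s' vIn = s vIn,
      (forall r, r != regS -> r != regD -> s' r = s r)
    & [/\ j <= k, usteps j c = Some c' & (step c' = None \/ j = k)]].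
Proof.
elim: k s c => [|k IH] s c Hs sD.
  exists s, 0, c; split=> //; last by split=> //; right.
  by apply: RunWhileF; rewrite /top sD andbF.
case E: (step c) => [c1|]; last first.
  exists s, 0, c; split=> //; last by split=> //; left.
  by apply: RunWhileF; rewrite (isSome_udelta Hs) E.
have [Hs1 In1 F1] := represents_ustep (fun t r =>
    if r == regD then [::] else keep t r) Hs E.
have [|s' [j [c' [R Hs' In' F' [Hj Hc Hend]]]]] := IH _ _ Hs1.
  by rewrite F1 //= sD.
exists s', j.+1, c'; split=> //.
- apply: RunWhileT R; [by rewrite (isSome_udelta Hs) E /top sD | exact: RunAct].
- by rewrite In'.
- move=> r HrS HrD; rewrite F' // F1 // (negbTE HrD); exact: act_keep_at.
split; [done | by rewrite iterSr /= E | by case: Hend => [|->]; [left|right]].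
Qed.

(** The last clause admits a state left over from an earlier run, which [initialize] overwrites. *)
Definition loaded (s : store) (x : bitseq) : Prop :=
  [/\ forall i, s (vL i) = [::],
      forall i, s (vR i) = if i == ord0 then map inl x else [::]
    & size (s regS) <= 1].

Definition initialize : cmd V A :=
  Act (fun t v => if v == vr regS then [:: inr (inr (tm_start U))] else keep t v).

Lemma run_initialize s x : loaded s x ->
  exists s', [/\ run initialize s s', represents s' (init_config U x),
    s' vIn = s vIn & forall r, r != regS -> s' r = s r].
Proof.
case=> sL sR sS; eexists; split; first exact: RunAct.
- have HL i : act (fun t v => if v == vr regS then [:: inr (inr (tm_start U))]
      else keep t v) s (vL i) = [::] by rewrite /act act_keep_at.
  have HR i : act (fun t v => if v == vr regS then [:: inr (inr (tm_start U))]
      else keep t v) s (vR i) = s (vR i) by rewrite /act act_keep_at.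
  split; first by rewrite /act eqxx /=; case: (s _) sS => [|a []].
  apply: functional_extensionality => i /=; rewrite HL HR sR.
  apply: zipperP => j; rewrite ?nth_nil; case: (i == ord0);
    rewrite /input_tape /blank_tape ?nth_nil //; case: Z.ltb_spec => // Hj; try lia.
  by rewrite Nat2Z.id -map_comp.
- by rewrite /act act_keep_at.
- by move=> r Hr; rewrite /act var_eqE; case: r Hr => // _; rewrite act_keep_at.
Qed.

Definition is_bit (a : letter) : bool := if a is inl _ then true else false.

Lemma tape_output_zipper l r y : tape_output (zipper l r) y <->
  exists2 r', r = map inl y ++ r' & ~~ oapp is_bit false (ohead r').
Proof.
have decP a b : dec a = Bit b -> a = inl b by case: a => [?|[[?|]|?]] //= [->].
split; last first.
  case=> r' -> Hr'; split=> [i Hi|b]; rewrite zipper_ge0 map_cat nth_cat !size_map.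
    by rewrite Hi -map_comp (nth_map false).
  rewrite ltnn subnn; case: r' Hr' => [|[?|[[?|]|?]] ?] //.
case=> H1 H2; exists (drop (size y) r).
  have Hs : size y <= size r.
    rewrite leqNgt; apply/negP => Hlt; have := H1 _ Hlt.
    by rewrite zipper_ge0 nth_default // size_map.
  rewrite -[LHS](cat_take_drop (size y)); congr cat.
  apply: (@eq_from_nth _ mark) => [|i].
    by rewrite size_take size_map; case: ltngtP Hs.
  rewrite size_take => Hi; have {}Hi : i < size y.
    by apply: leq_trans Hi _; case: ifP => // /negbT; rewrite -leqNgt.
  rewrite nth_take // (nth_map false) //.
  have := H1 _ Hi; rewrite zipper_ge0 (nth_map mark) ?(leq_trans Hi) //.
  exact: decP.
move: (H2); case E: (drop (size y) r) => [|a r'] // _.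
case: a E => [b|//] E; case: (H2 b); rewrite zipper_ge0.
have Hs : size y < size r by rewrite ltnNge; apply/negP=> /drop_oversize; rewrite E.
rewrite -[r](cat_take_drop (size y)) E map_cat nth_cat size_map.
by rewrite size_takel ?ltnn ?subnn // ltnW.
Qed.

Definition erase : cmd V A :=
  While (fun t => [exists w : bool * 'I_(tm_work U).+1, t (Some (inr w)) != None])
    (Act (fun t v => if v is Some (inr _) then [::] else keep t v)).

(** Each round pops all tape stacks at once; the induction is on a common bound for their
    heights. *)
Lemma run_erase (s : store) :
  run erase s (fun v => if v is Some (inr _) then [::] else s v).
Proof.
have [m Hm] : exists m, forall w, size (s (Some (inr w))) <= m.
  exists (\max_(w : bool * 'I_(tm_work U).+1) size (s (Some (inr w)))) => w.
  exact: (leq_bigmax (F := fun w => size (s (Some (inr w))))).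
elim: m s Hm => [|m IH] s Hm.
  apply: run_eq.
    apply: RunWhileF; apply/existsP => -[w]; have := Hm w.
    by rewrite /top; case: (s _).
  case=> [[r|w]|] //; have := Hm w; by case: (s _).
case E: [exists w : bool * 'I_(tm_work U).+1, top s (Some (inr w)) != None].
  apply: (RunWhileT E (RunAct _ _)); apply: run_eq.
    by apply: IH => w; rewrite /act /= size_behead; have := Hm w; case: size.
  by case=> [[r|w]|] //; rewrite /act act_keep_at.
apply: run_eq; first by apply: RunWhileF; rewrite E.
case=> [[r|w]|] //; move/negbT: E; rewrite negb_exists => /forallP /(_ w).
by rewrite /top; case: (s _).
Qed.

Lemma pushes_dest (vs : seq var) v (l : seq letter) :
  pushes (dest vs) v l = if v \in vs then l else [::].
Proof.
case: ifP => H; last by rewrite pushes_none // => a; rewrite /dest H.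
by rewrite (@pushes_some _ _ id) ?map_id // => a; rewrite /dest H.
Qed.

Lemma run_simulate s x k c :
  loaded s x -> usteps k (init_config U x) = Some c -> step c = None ->
  exists s', [/\ run (initialize ;; clocked) s s', represents s' c,
    s' vIn = s vIn & forall r, r != regS ->
      s' r = if r == regT then nseq k mark ++ s r else s r].
Proof.
move=> /run_initialize [s1 [R1 H1 In1 F1]] Hk Hc.
have [s' [R H In F]] := run_clocked H1 Hk Hc.
exists s'; split=> // [||r Hr]; [exact: RunSeq R1 R | by rewrite In |].
by rewrite F // F1.
Qed.

(** Turns the output of one run into the input of the next: the bits wait in [regB], reversed, while
    the rest of the tapes is erased. *)
Definition extract : cmd V A :=
  moveW vR0 is_bit (dest [:: vr regB]) ;; erase ;; move (vr regB) (dest [:: vR0]).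

Lemma run_extract s c y :
  represents s c -> tape_output (c.2 ord0) y -> s regB = [::] ->
  exists s', [/\ run extract s s', loaded s' y, s' vIn = s vIn
    & forall r : reg, s' r = s r].
Proof.
move=> [sS ->] /tape_output_zipper [r' E Hr'] sB.
eexists; split.
- apply: RunSeq; first by apply: (run_moveW _ E _ Hr'); elim: (y).
  apply: RunSeq; [exact: run_erase | exact: run_move].
- split=> [i|i|] /=.
  + by rewrite pushes_dest inE ?var_eqE.
  + rewrite pushes_dest cats0 inE ?var_eqE /=.
    rewrite pushes_dest inE eqxx sB cats0 revK; by case: (i == ord0).
  + by rewrite !pushes_dest !inE ?var_eqE /= sS.
- by rewrite /= !pushes_dest !inE ?var_eqE.
- by case; rewrite /= ?pushes_dest ?inE ?var_eqE //= ?pushes_dest ?inE ?var_eqE ?sB.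
Qed.

Definition load (r : reg) : cmd V A := copy (vr r) (vr regA) (dest [:: vR0]).

Lemma run_load r s x z : loaded s x -> s regA = [::] -> r != regA ->
  s r = map inl z ->
  exists s', [/\ run (load r) s s', loaded s' (z ++ x), s' vIn = s vIn
    & forall r' : reg, s' r' = s r'].
Proof.
move=> [sL sR sS] sA Hr E; eexists; split.
- exact: run_copy.
- split=> [i|i|] /=.
  + by rewrite ?var_eqE pushes_dest inE ?var_eqE /= sL.
  + rewrite ?var_eqE pushes_dest inE ?var_eqE /= sR E.
    by case: (i == ord0); rewrite ?map_cat.
  + by rewrite pushes_dest inE ?var_eqE /= if_same.
- by rewrite /= pushes_dest inE ?var_eqE.
- by move=> r'; rewrite /= pushes_dest inE ?var_eqE if_same.
Qed.

(** Loading puts [regP] in front of [regY], which gives the pairing of [q] with the current string;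
    the second run decompresses the output of the first. The clock adds up both runs, so it is at
    least the time of the decompression. *)
Definition measure_body : cmd V A :=
  load regY ;; load regP ;; (initialize ;; clocked) ;; extract ;;
  (initialize ;; clocked) ;; erase ;; inc _ (vr regY) (vr regC) (vr regA).

Lemma run_measure_body s p z y k c :
  loaded s [::] -> s regA = [::] -> s regB = [::] ->
  s regY = map inl z -> s regP = map inl p ->
  computes U (p ++ z) y -> usteps k (init_config U y) = Some c -> step c = None ->
  exists s' j, [/\ run measure_body s s', k <= j, loaded s' [::],
     s' vIn = s vIn
    & [/\ s' regY = map inl (succ z),
          s' regC = (if all id z then behead (s regC) else s regC),
          s' regT = nseq j mark ++ s regT
        & forall r, r \notin [:: regS; regY; regC; regT] -> s' r = s r]].
Proof.
move=> L0 sA sB sY sP [k1 [c1 [Hk1 Hc1 Hy]]] Hk Hc.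
have [s1 [R1 L1 In1 F1]] := run_load L0 sA (isT : regY != regA) sY.
have [||s2 [R2 L2 In2 F2]] := run_load L1 _ (isT : regP != regA) (z := p);
  rewrite ?F1 //.
rewrite cats0 in L2.
have [s3 [R3 H3 In3 F3]] := run_simulate L2 Hk1 Hc1.
have [|s4 [R4 L4 In4 F4]] := run_extract H3 Hy; first by rewrite F3 //= F2 F1.
have [s5 [R5 [H5 _] In5 F5]] := run_simulate L4 Hk Hc.
have Fall r : r != regS -> s5 r = if r == regT then nseq (k + k1) mark ++ s r else s r.
  move=> Hr; rewrite F5 // F4 F3 // F2 F1; case: (r == regT) => //.
  by rewrite nseqD catA.
eexists; exists (k + k1); split.
- apply: RunSeq R1 _; apply: RunSeq R2 _; apply: RunSeq R3 _.
  apply: RunSeq R4 _; apply: RunSeq R5 _; apply: RunSeq; first exact: run_erase.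
  by apply: (@run_inc _ _ _ _ _ _ z) => //=; rewrite Fall.
- exact: leq_addr.
- split=> [i|i|] //=; first by rewrite if_same.
  by rewrite ?var_eqE /= H5.
- by rewrite /= In5 In4 In3 In2 In1.
split.
- by rewrite eqxx.
- by rewrite ?var_eqE /= Fall.
- by rewrite ?var_eqE /= Fall.
- by move=> r; rewrite !inE !negb_or ?var_eqE => /and4P[HS HY HC HT];
    case: r HS HY HC HT => //= _ _ _ _; rewrite Fall.
Qed.

(** * Computing the time bound *)

Definition nonempty (v : var) (t : view) : bool := isSome (t v).

Definition halts_within (t : nat) (y z : bitseq) : Prop :=
  exists k c, [/\ k <= t, usteps k (init_config U y) = Some c, step c = None
    & tape_output (c.2 ord0) z].

Lemma halts_within_le t t' y z : t <= t' ->
  halts_within t y z -> halts_within t' y z.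
Proof.
by move=> Ht [k [c [Hk ? ? ?]]]; exists k, c; split=> //; apply: leq_trans Ht.
Qed.

(** The time bound concerns only the decompression of [y], not the computation of [y] from [z]. *)
Definition decodes_within (n t : nat) (q : bitseq) : Prop :=
  forall z, size z = n ->
    exists2 y, prog_computes U q z y & halts_within t y z.

Definition push (r : reg) (a : letter) : cmd V A :=
  Act (fun t v => if v == vr r then a :: keep t v else keep t v).

Lemma run_push r a s : run (push r a) s (fun v => if v == vr r then a :: s v else s v).
Proof.
apply: run_eq; first exact: RunAct.
by move=> v; rewrite /act; case: ifP => _; rewrite ?push_keep ?act_keep_at.
Qed.

Definition measure_loop : cmd V A := While (nonempty regC) measure_body.

Lemma run_measure_loop n q s : compression_function U n q ->
  loaded s [::] -> s vIn = [::] -> s regY = nseq n (inl false) ->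
  s regP = map inl (pairing q [::]) -> s regC = [:: mark] -> s regT = [::] ->
  s regA = [::] -> s regB = [::] ->
  exists s' t, [/\ run measure_loop s s', loaded s' [::], s' vIn = [::],
     decodes_within n t q & [/\ s' regT = nseq t mark, s' regC = [::]
       & forall r, r \notin [:: regS; regY; regC; regT] -> s' r = s r]].
Proof.
move=> Hq L In sY sP sC sT sA sB.
(* [z] is the string to be treated next and [t] the clock so far. [regC] holds one mark while [z]
   has length [n] and none afterwards. *)
pose I k s1 := exists z t, [/\ k = 2 ^ n.+1 - rank z, loaded s1 [::],
    s1 vIn = [::], s1 regY = map inl z
  & [/\ s1 regC = nseq (n.+1 - size z) mark, s1 regT = nseq t mark,
      forall r, r \notin [:: regS; regY; regC; regT] -> s1 r = s r, n <= size z
    & forall z', size z' = n -> rank z' < rank z ->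
        exists2 y, prog_computes U q z' y & halts_within t y z']].
have [||s' [j [R [z [t [_ L' In' _ [C' T' F' _ Hz]]]] Hb]]] :=
  @run_while_inv _ _ I (nonempty regC) measure_body _
    (2 ^ n.+1 - rank (nseq n false)) s.
- move=> k s1 [z [t [-> L1 In1 Y1 [C1 T1 F1 Hn Hz]]]].
  rewrite /nonempty /top C1; case Em: (n.+1 - size z) => [|m] //= _.
  have Ez : size z = n by lia.
  have [y Hy [k1 [c [Hk1 Hc Ho]]]] := Hq _ Ez.
  have Ep : map inl (pairing q [::]) = s1 regP :> seq letter by rewrite F1.
  have [|||s2 [j [R2 Hj L2 In2 [Y2 C2 T2 F2]]]] :=
    run_measure_body L1 _ _ Y1 (esym Ep) _ Hk1 Hc; rewrite ?F1 //.
    by move: Hy; rewrite /prog_computes /pairing /= cats0 -catA.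
  have := rank_bounds z; rewrite Ez => /andP[B1 B2].
  exists s2, (2 ^ n.+1 - rank (succ z)); split=> //; last by rewrite rank_succ; lia.
  exists (succ z), (j + t); split=> //; first by rewrite In2.
  split=> //.
  + rewrite C2 C1 size_succ Em Ez; case: (all id z) => /=.
      by congr nseq; lia.
    by have -> : n.+1 - (n + 0) = m.+1 by lia.
  + by rewrite T2 T1 nseqD.
  + by move=> r Hr; rewrite F2 ?F1.
  + by rewrite size_succ; lia.
  move=> z' Ez'; rewrite rank_succ ltnS leq_eqVlt => /orP[/eqP /rank_inj ->|Hlt].
    by exists y => //; exists k1, c; split=> //; lia.
  have [y' Hy' Hh] := Hz _ Ez' Hlt; exists y' => //.
  by apply: halts_within_le Hh; lia.
- exists (nseq n false), 0; split=> //; first by rewrite map_nseq.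
  split; rewrite ?size_nseq //; first by rewrite subSnn.
  (* The string of zeros comes first among those of length [n], so no decompression is claimed
     yet. *)
  move=> z' Ez' Hlt; exfalso.
  have : (rank (nseq n false)).+1 = 2 ^ n by elim: (n) => //= i; rewrite expnS; lia.
  have /andP[] := rank_bounds z'; rewrite Ez'; lia.
exists s', t; split=> //.
  (* An empty [regC] means that [z] is longer than [n], so every string of length [n] precedes
     it. *)
  move=> z' Ez'; apply: Hz => //; apply: size_lt_rank; rewrite Ez'.
  by move: Hb; rewrite /nonempty /top C'; case Em: (n.+1 - size z) => //; lia.
split=> //; move: Hb; rewrite /nonempty /top C'.
by case: (n.+1 - size z).
Qed.

Lemma pmap_Some (S T : Type) (g : S -> T) l :
  pmap (fun a => Some (g a)) l = map g l.
Proof. by elim: l => //= a l ->. Qed.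

Lemma pmap_None (S T : Type) (l : seq S) : pmap (fun=> @None T) l = [::].
Proof. by elim: l. Qed.

Definition fresh (s : store) (n : nat) : Prop :=
  [/\ loaded s [::], s regN = nseq n mark
    & forall r, r \notin [:: regS; regN] -> s r = [::]].

(** One mark in [regB] for each letter of [q] supplies the unary prefix of the pairing. The
    enumeration starts at [n] zeros, and the single mark in [regC] confines it to length [n]. *)
Definition measure_setup : cmd V A :=
  move vIn (dest [:: vr regA]) ;;
  move (vr regA) (fun a v => if v == vr regP then Some a
                        else if v == vr regB then Some mark else None) ;;
  push regP (inl false) ;;
  move (vr regB) (dest [:: vr regP]) ;;
  copy (vr regN) (vr regA)
    (fun _ v => if v == vr regY then Some (inl false) else None) ;;
  push regC mark.

Lemma run_measure_setup n q s : fresh s n -> s vIn = map inl q ->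
  exists s', [/\ run measure_setup s s', loaded s' [::], s' vIn = [::]
   & [/\ s' regP = map inl (pairing q [::]), s' regY = nseq n (inl false),
        s' regC = [:: mark]
      & forall r, r \notin [:: regS; regP; regY; regC] -> s' r = s r]].
Proof.
move=> [[sL sR sS] sN s0] In; eexists; split.
- apply: RunSeq; first exact: run_move.
  apply: RunSeq; first exact: run_move.
  apply: RunSeq; first exact: run_push.
  apply: RunSeq; first exact: run_move.
  apply: RunSeq; first apply: run_copy; last exact: run_push.
  + by rewrite /pushes /= pmap_None.
  + by [].
- split=> [i|i|]; rewrite /pushes /= ?pmap_None ?cats0 /=.
  + exact: sL.
  + exact: sR.
  + exact: sS.
- by rewrite /pushes /= ?pmap_None.
split.
- rewrite /pushes /= ?pmap_None ?pmap_Some /= !s0 // In !cats0 !map_id revK.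
  rewrite /pairing map_cat /= map_nseq cats0; congr cat.
  rewrite -map_rev -(size_map (@inl bool A) q) -size_rev.
  by elim: (rev _) => //= a l ->.
- rewrite /pushes /= ?pmap_None ?pmap_Some /= sN !s0 // !cats0 map_nseq //.
- by rewrite /pushes /= ?pmap_None ?pmap_Some /= !s0.
- by case=> // _; rewrite /pushes /= ?pmap_None ?pmap_Some /= ?[s regA]s0 ?[s regB]s0.
Qed.

Definition measure : cmd V A :=
  measure_setup ;; measure_loop ;; move (vr regY) (fun _ _ => None).

Lemma run_measure n q s : compression_function U n q ->
  fresh s n -> s vIn = map inl q ->
  exists s' t, [/\ run measure s s', loaded s' [::], s' vIn = [::],
     decodes_within n t q & [/\ s' regT = nseq t mark, s' regN = nseq n mark
       & forall r, r \notin [:: regS; regN; regP; regT] -> s' r = [::]]].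
Proof.
move=> Hq Hs In; have [s1 [R1 L1 In1 [P1 Y1 C1 F1]]] := run_measure_setup Hs In.
case: Hs => _ sN s0.
have [|||s2 [t [R2 [L2 LR2 S2] In2 Hd [T2 C2 F2]]]] :=
  run_measure_loop Hq L1 In1 Y1 P1 C1; rewrite ?F1 ?s0 //.
eexists; exists t; split.
- by apply: RunSeq R1 _; apply: RunSeq R2 _; apply: run_move.
- by split=> [i|i|]; rewrite /pushes /= ?pmap_None ?L2 ?LR2.
- by rewrite /pushes /= ?pmap_None.
- done.
split.
- by rewrite /pushes /= ?pmap_None.
- by rewrite /pushes /= ?pmap_None F2 ?F1.
- by case=> // _; rewrite /pushes /= ?pmap_None ?C2 ?F2 ?F1 ?s0.
Qed.

Lemma usteps_halted x j k c c' : usteps k x = Some c -> step c = None ->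
  usteps j x = Some c' -> j <= k.
Proof.
move=> Hk Hc Hj; rewrite leqNgt; apply/negP => Hlt; move: Hj.
by rewrite -(subnK Hlt) iterD iterS Hk /= Hc usteps_None.
Qed.

Lemma computes_inj x y y' : computes U x y -> computes U x y' -> y = y'.
Proof.
move=> [k [c [Hk Hc [O1 O2]]]] [k' [c' [Hk' Hc' [O1' O2']]]].
have Ek : k = k'.
  by apply/eqP; rewrite eqn_leq (usteps_halted Hk' Hc' Hk) (usteps_halted Hk Hc Hk').
move: Hk'; rewrite -Ek Hk => -[Ec]; move: O1' O2'; rewrite -Ec => O1' O2'.
have Es : size y = size y'.
  case: (ltngtP (size y) (size y')) => // Hlt.
    by case: (O2 (nth false y' (size y))); rewrite O1'.
  by case: (O2' (nth false y (size y'))); rewrite O1.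
apply: (@eq_from_nth _ false) => // i Hi.
by have := O1 _ Hi; rewrite O1' -?Es // => -[].
Qed.

(** * Searching for a string that is not output in time *)

Definition compare : cmd V A :=
  While (fun t => if (t regB, t vR0) is (Some (inl b), Some (inl b'))
                  then b == b' else false)
    (Act (fun t v => if (v == vr regB) || (v == vR0) then [::] else keep t v)).

(** An output is a maximal block of bits, so it must end where the candidate does. *)
Definition matched (t : view) : bool :=
  (t regB == None) && ~~ oapp is_bit false (t vR0).

(** By induction on the content of [regB]. The last clause is for the non-bit that marks a run cut
    off. *)
Lemma run_compare s : exists s', [/\ run compare s s',
    forall v, v != vr regB -> v != vR0 -> s' v = s v,
    forall z, s regB = map inl z -> matched (top s') <->
      exists2 r, s vR0 = map inl z ++ r & ~~ oapp is_bit false (ohead r)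
  & forall a l, s regB = inr a :: l -> ~~ matched (top s')].
Proof.
move E: (s regB) => l; elim: l s E => [|[b|a] l IH] s E.
- exists s; split=> //; first by apply: RunWhileF; rewrite /top E.
  case=> // _; rewrite /matched /top E /=; split; first by exists (s vR0).
  by case=> r ->.
- case ER: (s vR0) => [|[b'|a'] r].
  + exists s; split=> //; first by apply: RunWhileF; rewrite /top E ER.
    by move=> z; rewrite /matched /top E /=; case: z => //= ? ? [_ _]; split=> // -[].
  + have [Eb|Nb] := eqVneq b b'; last first.
      exists s; split=> //; first by apply: RunWhileF; rewrite /top E ER /= (negbTE Nb).
      case=> //= b1 z [Eb1 _]; rewrite /matched /top E /=; split=> // -[r' [E1]].
      by rewrite Eb1 -E1 eqxx in Nb.
    pose s1 := act (fun t v => if (v == vr regB) || (v == vR0) then [::]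
      else keep t v) s.
    have [|s' [R F Hm Ha]] := IH s1; first by rewrite /s1 /act /= E.
    exists s'; split=> //.
    * by apply: RunWhileT R; [rewrite /top E ER /= Eb | exact: RunAct].
    * move=> v Hv1 Hv2; rewrite F // /s1 /act (negbTE Hv1) (negbTE Hv2).
      exact: act_keep_at.
    * case=> //= b1 z [<- El]; apply: iff_trans (Hm _ El) _.
      have -> : s1 vR0 = r by rewrite /s1 /act eqxx orbT ER.
      rewrite -Eb; split=> -[r' Er Hr']; exists r' => //; first by rewrite Er.
      by case: Er.
  + exists s; split=> //; first by apply: RunWhileF; rewrite /top E ER.
    by case=> //= b1 z _; rewrite /matched /top E /=; split=> // -[].
- exists s; split=> //; first by apply: RunWhileF; rewrite /top E.
    by case.
  by move=> a' l' _; rewrite /matched /top E.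
Qed.

Definition attempt : cmd V A :=
  load regY ;;
  (copy (vr regT) (vr regA) (dest [:: vr regD]) ;;
   copy (vr regZ) (vr regA) (dest [:: vr regB])) ;;
  initialize ;; budgeted ;;
  (* A run that is cut off must not match, so a non-bit is put into B. *)
  Act (fun t v => if (v == vr regB) && isSome (udelta t)
                  then inr (inl None) :: keep t v else keep t v) ;;
  compare.

Lemma run_attempt s t y z :
  loaded s [::] -> s regY = map inl y -> s regZ = map inl z ->
  s regT = nseq t mark -> s regA = [::] -> s regB = [::] -> s regD = [::] ->
  exists s', [/\ run attempt s s', matched (top s') <-> halts_within t y z,
     size (s' regS) <= 1, s' vIn = s vIn
   & forall r, r \notin [:: regS; regB; regD] -> s' r = s r].
Proof.
move=> L sY sZ sT sA sB sD.
have [s1 [R1 L1 In1 F1]] := run_load L sA (isT : regY != regA) sY.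
rewrite cats0 in L1.
have [s2 [R2 L2 In2 [B2 D2 F2]]] : exists s2, [/\
    run (copy (vr regT) (vr regA) (dest [:: vr regD]) ;;
         copy (vr regZ) (vr regA) (dest [:: vr regB])) s1 s2,
    loaded s2 y, s2 vIn = s vIn & [/\ s2 regB = map inl z, s2 regD = nseq t mark
    & forall r, r \notin [:: regS; regB; regD] -> s2 r = s r]].
  case: L1 => sL sR sS; eexists; split.
  - apply: RunSeq; first by apply: run_copy => //; rewrite F1.
    by apply: run_copy => //=; rewrite F1.
  - by split=> [i|i|]; rewrite /pushes /= ?pmap_None ?sL ?sR.
  - by rewrite /pushes /= ?pmap_None In1.
  split.
  - by rewrite /pushes /= !pmap_None pmap_Some map_id !F1 sB sZ cats0.
  - by rewrite /pushes /= !pmap_None pmap_Some map_id !F1 sD sT cats0.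
  - by case=> // _; rewrite /pushes /= ?pmap_None F1.
have [s3 [R3 H3 In3 F3]] := run_initialize L2.
have [|s4 [j [c [R4 H4 In4 F4 [Hj Hc Hend]]]]] := run_budgeted H3 (k := t).
  by rewrite F3.
pose f : action V A := fun t v => if (v == vr regB) && isSome (udelta t)
                  then inr (inl None) :: keep t v else keep t v.
have Ef v : v != vr regB -> act f s4 v = s4 v.
  by move=> Hv; rewrite /act /f (negbTE Hv) act_keep_at.
have Bf : act f s4 regB = if isSome (step c) then inr (inl None) :: map inl z
    else map inl z.
  rewrite /act /f eqxx (isSome_udelta H4) /=.
  by case: isSome; rewrite ?push_keep ?act_keep_at F4 // F3 // B2.
have [s5 [R5 F5 Hm Ha]] := run_compare (act f s4).
exists s5; split.
- apply: RunSeq R1 _; apply: RunSeq R2 _; apply: RunSeq R3 _.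
  by apply: RunSeq R4 _; apply: RunSeq R5; apply: RunAct.
- case Es: (step c) Bf => [c1|] /= Bf.
    (* A run that is cut off has spent all [t] steps without halting, so no halting configuration
       occurs within [t] steps. *)
    split=> [Hm1|[k [c' [Hk Hc' Hs' _]]]].
      by have := Ha _ _ Bf; rewrite Hm1.
    have Ejt : j = t by case: Hend => //; rewrite Es.
    have Ekj : k = j.
      by apply/eqP; rewrite eqn_leq (usteps_halted Hc' Hs' Hc) Ejt Hk.
    by move: Hc'; rewrite Ekj Hc => -[Ec]; rewrite -Ec Es in Hs'.
  rewrite (Hm _ Bf) Ef //; case: (H4) => _ H4c; split.
    case=> r Er Hr; exists j, c; split=> //.
    by rewrite H4c; apply/tape_output_zipper; exists r.
  move=> [k [c' [Hk Hc' Hs' Ho]]].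
  have Ekj : k = j.
    by apply/eqP; rewrite eqn_leq (usteps_halted Hc Es Hc') (usteps_halted Hc' Hs' Hc).
  move: Hc'; rewrite Ekj Hc => -[Ec]; rewrite -Ec H4c in Ho.
  by case/tape_output_zipper: Ho => r Er Hr; exists r.
- by rewrite F5 // Ef //; case: H4 => ->.
- by rewrite F5 // Ef // In4 In3.
- by move=> r; rewrite !inE !negb_or => /and3P[HS HB HD];
    rewrite F5 // Ef // F4 // F3 // F2 // !inE !negb_or HS HB.
Qed.

Definition clear (r : reg) : cmd V A := move (vr r) (fun _ _ => None).

Lemma run_clear r s : run (clear r) s (fun v => if v == vr r then [::] else s v).
Proof. by apply: run_eq (run_move _ _ _) _ => v; rewrite /pushes pmap_None. Qed.

(** A match refutes the candidate, and the enumeration of the strings shorter than [n] restarts for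
    the next one; otherwise the next such string is tried. *)
Definition search_body : cmd V A :=
  attempt ;;
  If matched
    (inc _ (vr regZ) (vr regB) (vr regA) ;; clear regY ;; clear regC ;;
     copy (vr regN) (vr regA) (dest [:: vr regC]))
    (inc _ (vr regY) (vr regC) (vr regA)) ;;
  clear regB ;; clear regD ;; erase.

Lemma run_search_body s n t y z :
  loaded s [::] -> s regN = nseq n mark ->
  s regY = map inl y -> s regZ = map inl z ->
  s regT = nseq t mark -> s regA = [::] -> s regB = [::] -> s regD = [::] ->
  exists s', [/\ run search_body s s', loaded s' [::], s' vIn = s vIn,
     forall r, r \notin [:: regS; regY; regZ; regC] -> s' r = s r
   & ([/\ halts_within t y z, s' regZ = map inl (succ z), s' regY = [::]
        & s' regC = nseq n mark] \/
      [/\ ~ halts_within t y z, s' regZ = map inl z, s' regY = map inl (succ y)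
        & s' regC = if all id y then behead (s regC) else s regC])].
Proof.
move=> L sN sY sZ sT sA sB sD.
have [s1 [R1 Hm S1 In1 F1]] := run_attempt L sY sZ sT sA sB sD.
case E: (matched (top s1)).
  have Hh : halts_within t y z by apply/Hm; rewrite E.
  eexists; split.
  - apply: RunSeq R1 _; apply: RunSeq.
      apply: RunIf; rewrite E; apply: RunSeq.
        by apply: (@run_inc _ _ _ _ _ _ z) => //; rewrite F1.
      apply: RunSeq; first exact: run_clear.
      apply: RunSeq; first exact: run_clear.
      by apply: run_copy => //=; rewrite F1.
    apply: RunSeq; first exact: run_clear.
    apply: RunSeq; [exact: run_clear | exact: run_erase].
  - by split=> [i|i|]; rewrite /pushes /= ?pmap_None ?if_same.
  - by rewrite /pushes /= ?pmap_None In1.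
  - by case=> // _; rewrite /pushes /= ?pmap_None ?sB ?sD // F1.
  left; split; rewrite /pushes /= ?pmap_None ?pmap_Some ?map_id ?cats0 ?F1 //.
eexists; split.
- apply: RunSeq R1 _; apply: RunSeq.
    apply: RunIf; rewrite E.
    by apply: (@run_inc _ _ _ _ _ _ y) => //; rewrite F1.
  apply: RunSeq; first exact: run_clear.
  apply: RunSeq; [exact: run_clear | exact: run_erase].
- by split=> [i|i|]; rewrite /= ?if_same.
- by rewrite /= In1.
- by case=> // _; rewrite /= ?sB ?sD // F1.
right; split=> /=; rewrite ?F1 //.
by move/Hm; rewrite E.
Qed.

Definition search : cmd V A :=
  copy (vr regN) (vr regA) (fun a v => if v == vr regZ then Some (inl false)
    else if v == vr regC then Some mark else None) ;;
  While (nonempty regC) search_body.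

(** The string [x] guarantees termination, since no candidate passes it; the search may stop
    earlier, at another string with the same property. *)
Lemma run_search s n t x :
  loaded s [::] -> s regN = nseq n mark -> s regT = nseq t mark ->
  s vIn = [::] ->
  (forall r, r \notin [:: regS; regN; regP; regT] -> s r = [::]) ->
  size x = n -> (forall y, size y < n -> ~ halts_within t y x) ->
  exists s' z, [/\ run search s s', s' vIn = [::], s' regZ = map inl z,
     s' regA = [::] & size z = n /\ forall y, size y < n -> ~ halts_within t y z].
Proof.
move=> [sL sR sS] sN sT In s0 Hx Hmiss.
have [s1 [R1 L1 In1 [Z1 C1 F1]]] : exists s1, [/\
    run (copy (vr regN) (vr regA) (fun a v => if v == vr regZ
      then Some (inl false) else if v == vr regC then Some mark else None)) s s1,
    loaded s1 [::], s1 vIn = [::] & [/\ s1 regZ = nseq n (inl false),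
      s1 regC = nseq n mark
    & forall r, r \notin [:: regZ; regC] -> s1 r = s r]].
  eexists; split.
  - by apply: run_copy => //; rewrite s0.
  - by split=> [i|i|]; rewrite /pushes /= ?pmap_None ?sL ?sR.
  - by rewrite /pushes /= ?pmap_None.
  split.
  - by rewrite /pushes /= pmap_Some sN map_nseq s0 ?cats0.
  - by rewrite /pushes /= pmap_Some sN map_nseq s0 ?cats0.
  - by case=> // _; rewrite /pushes /= ?pmap_None.
have Bx := rank_bounds x; rewrite Hx in Bx.
(* The variant is lexicographic: candidates left up to [x], then strings [y] left for the current
   candidate, of which there are fewer than 2^n. *)
pose I k s2 := exists y z, [/\ loaded s2 [::], s2 vIn = [::],
    s2 regY = map inl y, s2 regZ = map inl z
  & [/\ s2 regC = nseq (n - size y) mark,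
      forall r, r \notin [:: regS; regY; regZ; regC] -> s2 r = s r,
      size z = n, rank z <= rank x
    & (forall y', rank y' < rank y -> ~ halts_within t y' z) /\
      k = (rank x - rank z) * 2 ^ n + (2 ^ n - rank y)]].
have [||s' [j [R [y [z [L' In' Y' Z' [C' F' Ez Hz [Hy _]]]]] Hb]]] :=
  @run_while_inv _ _ I (nonempty regC) search_body _
    ((rank x - rank (nseq n false)) * 2 ^ n + 2 ^ n) s1.
- move=> k s2 [y [z [L2 In2 Y2 Z2 [C2 F2 Ez Hz [Hy ->]]]]].
  rewrite /nonempty /top C2; case Em: (n - size y) => [|m] //= _.
  have [|||||s3 [R3 L3 In3 F3 H3]] := run_search_body L2 _ Y2 Z2 (n := n) (t := t);
    rewrite ?F2 ?sN ?sT ?s0 //.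
  have /andP[By1 By2] := rank_bounds y.
  have Hyn : 2 ^ (size y).+1 <= 2 ^ n by rewrite leq_exp2l //; lia.
  case: H3 => [[Hh Z3 Y3 C3]|[Hh Z3 Y3 C3]].
    (* The candidate just refuted cannot be [x], which no [y] shorter than [n] outputs in time. *)
    have Nzx : rank z < rank x.
      rewrite ltn_neqAle Hz andbT; apply/eqP => /rank_inj Ezx.
      by apply: (Hmiss y); [lia | rewrite -Ezx].
    exists s3, ((rank x - rank (succ z)) * 2 ^ n + (2 ^ n - 0)); split=> //.
    + exists [::], (succ z); split=> //; first by rewrite In3.
      split=> //.
      * by rewrite subn0.
      * by move=> r Hr; rewrite F3 ?F2.
      (* The next candidate still has length [n], because its rank is at most that of [x]. *)
      * have Hge : n <= size (succ z) by rewrite size_succ Ez; lia.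
        apply/eqP; rewrite eqn_leq Hge andbT -ltnS.
        by apply: rank_lt_size; rewrite rank_succ; lia.
      * by rewrite rank_succ.
    + rewrite rank_succ /= subn0.
      have -> : rank x - rank z = (rank x - (rank z).+1).+1 by lia.
      by rewrite mulSn; lia.
  exists s3, ((rank x - rank z) * 2 ^ n + (2 ^ n - rank (succ y))); split=> //.
  + exists (succ y), z; split=> //; first by rewrite In3.
    split=> //.
    * rewrite C3 C2 Em size_succ; case: (all id y) => /=.
        by congr nseq; lia.
      by have -> : n - (size y + 0) = m.+1 by lia.
    * by move=> r Hr; rewrite F3 ?F2.
    split=> // y'; rewrite rank_succ ltnS leq_eqVlt => /orP[/eqP /rank_inj ->|] //.
    exact: Hy.
  + by rewrite rank_succ; lia.
- exists [::], (nseq n false); split=> //; rewrite ?map_nseq //.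
    by rewrite F1 // s0.
  split=> //=; rewrite ?subn0 ?size_nseq //.
  + by move=> r; rewrite !inE !negb_or => /and4P[_ _ HZ HC]; rewrite F1 // !inE negb_or HZ.
  + have : (rank (nseq n false)).+1 = 2 ^ n by elim: (n) => //= i; rewrite expnS; lia.
    lia.
exists s', z; split=> //.
- exact: RunSeq R1 R.
- by rewrite F' // s0.
split=> // y' Hy'; apply: Hy; apply: size_lt_rank; apply: leq_trans Hy' _.
by move: Hb; rewrite /nonempty /top C'; case Em: (n - size y) => //; lia.
Qed.

(** * The whole program *)

Definition pop_input : cmd V A :=
  Act (fun t v => if v == vIn then [::] else keep t v).

Lemma run_pop_input s :
  run pop_input s (fun v => if v == vIn then behead (s v) else s v).
Proof.
apply: run_eq; first exact: RunAct.
by move=> v; rewrite /act; case: ifP => _ //; rewrite act_keep_at.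
Qed.

Definition is_one (o : option letter) : bool :=
  if o is Some (inl b) then b else false.

Definition double : cmd V A :=
  move (vr regN) (dest [:: vr regA; vr regB]) ;;
  move (vr regA) (dest [:: vr regN]) ;; move (vr regB) (dest [:: vr regN]).

(** A step of Horner's rule in bijective binary notation, with digit 1 for [false] and 2 for [true],
    as in [rank]. *)
Definition decode_body : cmd V A :=
  double ;;
  push regN mark ;; pop_input ;;
  If (fun t => is_one (t vIn)) (push regN mark) (Act (@keep _ _)) ;; pop_input.

Definition decode : cmd V A :=
  While (fun t => is_one (t vIn)) decode_body ;; pop_input.

(** A self-delimiting code: [true] announces a bit and [false] ends the code, so that [q] may
    follow. *)
Definition bits_code (s : bitseq) : bitseq :=
  flatten [seq [:: true; b] | b <- s] ++ [:: false].

Lemma run_decode_body s m b l : fresh s m ->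
  s vIn = [:: inl true, inl b & l] ->
  exists s', [/\ run decode_body s s', fresh s' (m.*2 + b.+1) & s' vIn = l].
Proof.
move=> [[sL sR sS] sN s0] In.
have [s1 [R1 [L1 LR1 S1] In1 [N1 F1]]] : exists s1, [/\ run double s s1,
    loaded s1 [::], s1 vIn = s vIn & s1 regN = nseq (m + m) mark /\
    forall r, r \notin [:: regS; regN] -> s1 r = [::]].
  eexists; split.
  - apply: RunSeq; first exact: run_move.
    by apply: RunSeq; exact: run_move.
  - by split=> [i|i|]; rewrite /pushes /= ?pmap_None ?sL ?sR.
  - by rewrite /pushes /= ?pmap_None.
  split.
  - rewrite /pushes /= ?pmap_None ?pmap_Some ?map_id sN !s0 //= !cats0.
    by rewrite !rev_nseq nseqD.
  - by case=> // _; rewrite /pushes /= ?pmap_None ?s0.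
eexists; split.
- apply: RunSeq R1 _; apply: RunSeq; first exact: run_push.
  apply: RunSeq; first exact: run_pop_input.
  apply: RunSeq; last exact: run_pop_input.
  apply: RunIf; rewrite /top /= In1 In /=.
  (* Both branches of the test end in this store; the digit [b] is popped afterwards. *)
  instantiate (1 := fun v => if v == vIn then inl b :: l
    else if v == vr regN then nseq (m.*2 + b.+1) mark else s1 v).
  case: b In => In; apply: run_eq; try exact: run_push; try exact: RunAct;
    rewrite ?act_keep; case=> [[[]|i]|] //=;
    rewrite ?In1 ?In ?N1 ?addnn ?addn2 ?addn1 //.
- split=> //=; last by case=> //= _; rewrite F1.
  by split=> [i|i|]; rewrite /= ?L1 ?LR1.
Qed.

Lemma run_decode bs m s l : fresh s m ->
  s vIn = map inl (bits_code bs) ++ l ->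
  exists s', [/\ run decode s s',
    fresh s' (foldl (fun a (b : bool) => a.*2 + b.+1) m bs) & s' vIn = l].
Proof.
move=> Hs In; have [s1 [R1 H1 In1]] : exists s1, [/\
    run (While (fun t => is_one (t vIn)) decode_body) s s1,
    fresh s1 (foldl (fun a (b : bool) => a.*2 + b.+1) m bs)
  & s1 vIn = inl false :: l].
  elim: bs m s Hs In => [|b bs IH] m s Hs In.
    by exists s; split=> //; apply: RunWhileF; rewrite /top In.
  have [s1 [R1 H1 In1]] := run_decode_body Hs In.
  have [s2 [R2 H2 In2]] := IH _ _ H1 In1.
  by exists s2; split=> //; apply: RunWhileT R1 R2; rewrite /top In.
case: H1 => [[L1 LR1 S1] N1 F1]; eexists; split.
- by apply: RunSeq R1 _; apply: run_pop_input.
- by split=> //=; split.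
- by rewrite /= In1.
Qed.

Definition output : cmd V A :=
  move (vr regZ) (dest [:: vr regA]) ;; move (vr regA) (dest [:: vIn]).

(** After the code of [n] comes nothing, or [true] and then [q]; this flag tells an empty [q] from
    an absent one. Without [q] the time bound is zero. *)
Definition program : cmd V A :=
  decode ;;
  If (nonempty vIn) (pop_input ;; measure) (Act (@keep _ _)) ;;
  search ;; output.

Lemma halts_within_computes t y z : halts_within t y z -> computes U y z.
Proof. by case=> k [c [_ ? ? ?]]; exists k, c. Qed.

(* There are fewer programs of length below [n] than strings of length [n]. *)
Lemma exists_missed n t : exists x, size x = n /\
  forall y, size y < n -> ~ halts_within t y x.
Proof.
apply: NNPP => Hno.
(* If no string is missed, each one has a program of rank below 2^n - 1, and distinct strings have
   distinct programs: a contradiction by counting. *)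
have [f Hf] : exists f : n.-tuple bool -> 'I_(2 ^ n).-1,
    forall x, exists2 y, rank y = f x & halts_within t y x.
  apply: (@fin_all_exists (n.-tuple bool) (fun=> 'I_(2 ^ n).-1)
    (fun x i => exists2 y, rank y = i & halts_within t y x)) => x; apply: NNPP => Hx; apply: Hno.
  exists x; split; first exact: size_tuple.
  move=> y Hy Hh; apply: Hx.
  have Hr : rank y < (2 ^ n).-1.
    have /andP[_ H1] := rank_bounds y.
    have : 2 ^ (size y).+1 <= 2 ^ n by rewrite leq_exp2l.
    lia.
  by exists (Ordinal Hr), y.
have finj : injective f.
  move=> x x' E; have [y Hy Hh] := Hf x; have [y' Hy' Hh'] := Hf x'.
  have Eyy : y = y' by apply: rank_inj; rewrite Hy Hy' E.
  apply: val_inj; apply: (computes_inj (halts_within_computes Hh)).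
  by rewrite Eyy; apply: halts_within_computes Hh'.
have := leq_card f finj; rewrite card_tuple card_bool card_ord.
have := expn_gt0 2 n; lia.
Qed.

(** Horner's rule reads the most significant digit first, [rank] the least; hence the code given to
    the program is that of [rev s]. *)
Lemma foldl_rank s : foldl (fun a (b : bool) => a.*2 + b.+1) 0 (rev s) = rank s.
Proof. by rewrite foldl_rev; elim: s => //= b s ->. Qed.

Lemma fresh_input x : fresh (@input_store V A x) 0.
Proof. by split=> //; split=> // i; rewrite /= if_same. Qed.

Lemma run_output s z : s vIn = [::] -> s regZ = map inl z -> s regA = [::] ->
  exists2 s', run output s s' & s' vIn = map inl z.
Proof.
move=> In sZ sA; eexists.
  by apply: RunSeq; apply: run_move.
by rewrite /pushes /= ?pmap_None ?pmap_Some ?map_id sZ sA In !cats0 revK.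
Qed.

(** For the case that no compression function is short enough: only low complexity is then asked of
    the string. *)
Lemma program_short s n : rank s = n ->
  exists2 x, computes (stack_machine program) (bits_code (rev s)) x & size x = n.
Proof.
move=> Hs; have [x [Hx Hmiss]] := exists_missed n 0.
have [|s1 [R1 H1 In1]] := @run_decode (rev s) 0 _ [::] (fresh_input (bits_code (rev s))).
  by rewrite cats0.
rewrite foldl_rank Hs in H1; case: H1 => [L1 N1 F1].
have [||s2 [z [R2 In2 Z2 A2 [Hz _]]]] := @run_search s1 n 0 x L1 N1 _ In1 _ Hx Hmiss.
- by rewrite F1.
- by move=> r; rewrite !inE !negb_or => /and4P[HS HN _ _]; rewrite F1 // !inE negb_or HS.
have [s3 R3 In3] := run_output In2 Z2 A2.
exists z => //; apply: run_computes In3.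
apply: RunSeq R1 _; apply: RunSeq; last by apply: RunSeq R2 R3.
by apply: RunIf; rewrite /nonempty /top In1 /= -{2}(act_keep s1); apply: RunAct.
Qed.

Lemma program_diagonal s n q : rank s = n -> compression_function U n q ->
  exists x t, [/\ computes (stack_machine program) (bits_code (rev s) ++ true :: q) x,
    size x = n, decodes_within n t q
  & forall y, size y < n -> ~ halts_within t y x].
Proof.
move=> Hs Hq.
have [|s1 [R1 H1 In1]] := @run_decode (rev s) 0 _ (map inl (true :: q))
  (fresh_input (bits_code (rev s) ++ true :: q)); first by rewrite -map_cat.
rewrite foldl_rank Hs in H1.
have R1' := run_pop_input s1; set s1' := (fun v => _) in R1'.
have [||s2 [t [R2 L2 In2 Hd [T2 N2 F2]]]] := @run_measure n q s1' Hq.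
- by case: H1 => [[? ? ?] ? ?]; split.
- by rewrite /s1' /= In1.
have [x [Hx Hmiss]] := exists_missed n t.
have [s3 [z [R3 In3 Z3 A3 [Hz Hmz]]]] := run_search L2 N2 T2 In2 F2 Hx Hmiss.
have [s4 R4 In4] := run_output In3 Z3 A3.
exists z, t; split=> //; apply: run_computes In4.
apply: RunSeq R1 _; apply: RunSeq; last by apply: RunSeq R3 R4.
by apply: RunIf; rewrite /nonempty /top In1 /=; apply: RunSeq R1' R2.
Qed.

End UniversalRun.

(** * The theorem *)

(** As [R] is monotone in time, the sets of admissible times are ordered by inclusion, and among
    finitely many there is a smallest. The induction compares each new [q1] with the slowest so
    far. *)
Lemma exists_slowest (P : bitseq -> Prop) (R : nat -> bitseq -> Prop) N :
  (forall t t' q, t <= t' -> R t q -> R t' q) ->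
  (forall q, rank q < N -> ~ P q) \/
  exists2 q, P q &
    forall t, R t q -> forall q', rank q' < N -> P q' -> R t q'.
Proof.
move=> Rle; elim: N => [|N IH]; first by left.
have [q1 Eq1] := rank_onto N.
have split_le q : rank q < N.+1 -> q = q1 \/ rank q < N.
  rewrite ltnS leq_eqVlt => /orP[/eqP E|]; last by right.
  by left; apply: rank_inj; rewrite Eq1.
have [P1|nP1] := classic (P q1); last first.
  case: IH => [IH|[q Pq Hq]].
    by left=> q /split_le [->|/IH].
  right; exists q => // t Rt q' /split_le [->|Hr] // P'.
  exact: Hq.
right; case: IH => [IH|[q Pq Hq]].
  by exists q1 => // t Rt q' /split_le [->|/IH].
have [Hle|Hnle] := classic (forall t, R t q -> R t q1).
  exists q => // t Rt q' /split_le [-> _|Hr P']; [exact: Hle | exact: Hq].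
exists q1 => // t Rt q' /split_le [->|Hr] // P'; apply: Hq => //.
apply: NNPP => nRt; apply: Hnle => t' Rt'.
(* [R t q1] holds while [R t q] fails, so [q1] is slower than [q]. *)
have [Htt|Htt] := leqP t t'; first exact: Rle Rt.
by case: nRt; apply: Rle Rt'; apply: ltnW.
Qed.

(** * Complexity and length estimates *)

Lemma kolmogorov_exists U x p : computes U p x ->
  exists2 C, kolmogorov U x C & C <= size p.
Proof.
have [n] := ubnP (size p); elim: n p => // n IH p Hp Hc.
have [[p' Hlt Hc']|Hno] :=
    classic (exists2 p', size p' < size p & computes U p' x).
  by have [|C HC Hle] := IH p' _ Hc'; [lia | exists C => //; lia].
exists (size p) => //; split; first by exists p.
by move=> p' Hc'; rewrite leqNgt; apply/negP => Hlt; apply: Hno; exists p'.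
Qed.

Lemma size_pairing p x : size (pairing p x) = (size p).*2.+1 + size x.
Proof. rewrite /pairing size_cat size_nseq /= size_cat; lia. Qed.

Lemma size_bits_code s : size (bits_code s) = (size s).*2.+1.
Proof. by rewrite /bits_code size_cat /=; elim: s => //= b s; lia. Qed.

Lemma ln_le x y : (0 < x)%R -> (x <= y)%R -> (ln x <= ln y)%R.
Proof.
move=> x0 [xy|->]; last exact: Rle_refl.
by apply: Rlt_le; apply: ln_increasing.
Qed.

Lemma log2_maxn_ge1 n : (1 <= log2 (maxn n 2))%R.
Proof.
rewrite /log2; have H2 : (0 < ln 2)%R by rewrite -ln_1; apply: ln_increasing; lra.
apply: (Rmult_le_reg_r (ln 2)) => //.
rewrite /Rdiv Rmult_assoc Rinv_l; last lra.
rewrite Rmult_1_l Rmult_1_r.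
apply: ln_le; first lra.
by have -> : 2%R = INR 2 by []; apply: le_INR; lia.
Qed.

(** With N the maximum, 2^|s| <= rank s + 1 <= N + 1 <= N^2; the factor 2 absorbs the added one. *)
Lemma size_le_log2 s : (INR (size s) <= 2 * log2 (maxn (rank s) 2))%R.
Proof.
rewrite /log2; have H2 : (0 < ln 2)%R by rewrite -ln_1; apply: ln_increasing; lra.
apply: (Rmult_le_reg_r (ln 2)) => //.
rewrite /Rdiv -Rmult_assoc Rmult_assoc Rinv_l; last lra.
set N := maxn _ _; have HN : (0 < INR N)%R by apply: lt_0_INR; lia.
have -> : (2 * ln (INR N) * 1 = ln (INR N * INR N))%R by rewrite ln_mult //; ring.
rewrite -ln_pow; last lra.
apply: ln_le; first by apply: pow_lt; lra.
have -> : 2%R = INR 2 by []; rewrite -pow_INR -mult_INR; apply: le_INR.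
have /andP[H _] := rank_bounds s.
have -> : Nat.pow 2 (size s) = 2 ^ size s.
  by elim: (size s) => //= k ->; rewrite expnS; lia.
have : rank s <= N by rewrite leq_maxl.
have : 2 <= N by rewrite leq_maxr.
nia.
Qed.

(* [log2 (maxn n 2)] is log n for n >= 2; log 0 is undefined, and since
   log 1 = 0 the bound C(x) <= m + k log n would fail at n = 1. *)
Theorem theorem2 (U : turing_machine) (hU : universal U) :
  exists k : nat, forall m n : nat, m <= n ->
  exists (x : bitseq) (C : nat),
    kolmogorov U x C /\
    size x = n /\
    (INR C <= INR m + INR k * log2 (maxn n 2))%R /\
    (forall q : bitseq, compression_function U n q ->
       (INR (size q) <= INR m - INR k * log2 (maxn n 2))%R ->
       forall y : bitseq, prog_computes U q x y -> n <= size y) /\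
    (forall q : bitseq, compression_function U n q ->
       (INR (size q) <= INR m - INR k * log2 (maxn n 2))%R ->
       forall y : bitseq, prog_computes U q x y ->
         (INR (size y) - INR C >= INR n - INR m - INR k * log2 (maxn n 2))%R).
Proof.
have [p Hp] := hU (stack_machine (program U)).
(* The overhead is at most 2|p| + 2|s| + 3: the pairing with [p], the code of [n], and three single
   bits. Since |s| <= 2L and L >= 1, it is at most (2|p| + 4 + 3) L. *)
exists ((size p).*2 + 7) => m n _; set k := _ + 7; set L := log2 _.
have L1 : (1 <= L)%R := log2_maxn_ge1 n.
have [s Es] := rank_onto n.
have sL : (INR (size s) <= 2 * L)%R by rewrite /L -Es; apply: size_le_log2.
have short : (INR ((size p).*2 + (size s).*2 + 3) <= INR k * L)%R.
  rewrite /k -!muln2 !plus_INR !mult_INR /=.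
  have := pos_INR (size p); nra.
have m0 := pos_INR m; have k0 := pos_INR k.
pose P q := compression_function U n q /\ (INR (size q) <= INR m - INR k * L)%R.
suff [x [C [HC Hx Cm Hq]]] : exists x C, [/\ kolmogorov U x C, size x = n,
    (INR C <= INR m + INR k * L)%R
  & forall q y, P q -> prog_computes U q x y -> n <= size y].
  exists x, C; do 4!split=> //.
    by move=> q Hq1 Hq2 y; apply: Hq.
  move=> q Hq1 Hq2 y /(Hq _ _ (conj Hq1 Hq2)) Hy.
  have : (INR n <= INR (size y))%R by apply: le_INR; lia.
  lra.
(* The family is finite, because its members have length at most [m]. *)
have Pm q : P q -> rank q < 2 ^ m.+1.
  case=> _ Hq; have Hsz : size q <= m.
    by apply/leP; apply: INR_le; nra.
  have /andP[_ H] := rank_bounds q.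
  have : 2 ^ (size q).+1 <= 2 ^ m.+1 by rewrite leq_exp2l.
  lia.
have [] := @exists_slowest P (fun t q => decodes_within U n t q) (2 ^ m.+1).
- move=> t t' q Ht Hq z /Hq [y Hy Hh]; exists y => //.
  exact: halts_within_le Hh.
(* With an empty family only the length and the complexity of [x] matter. *)
- move=> none; have [x Hx Sx] := program_short U Es.
  have [C HC CL] := kolmogorov_exists (Hp _ _ Hx).
  exists x, C; split=> //.
    move/leP/le_INR: CL; rewrite size_pairing size_bits_code size_rev.
    have : (INR ((size p).*2.+1 + (size s).*2.+1) <=
            INR ((size p).*2 + (size s).*2 + 3))%R by apply: le_INR; lia.
    lra.
  by move=> q y Pq; case: (none q (Pm _ Pq) Pq).
case=> q [Hq Hqm] slow.
have [x [t [Hx Sx Hd Hmiss]]] := program_diagonal Es Hq.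
have [C HC CL] := kolmogorov_exists (Hp _ _ Hx).
exists x, C; split=> //.
  (* The program for [x] consists of [q] and an overhead of at most kL. *)
  move/leP/le_INR: CL; rewrite size_pairing size_cat size_bits_code size_rev.
  have : (INR ((size p).*2.+1 + ((size s).*2.+1 + size (true :: q))) <=
          INR ((size p).*2 + (size s).*2 + 3) + INR (size q))%R.
    by rewrite -plus_INR; apply: le_INR => /=; lia.
  nra.
move=> q' y Pq' Hy; rewrite leqNgt; apply/negP => Hlt.
(* The bound [t] for the slowest [q] holds for [q'] too, so its output on [x], if shorter than [n],
   would give [x] in time. *)
have [y' Hy' Hh] := slow _ Hd _ (Pm _ Pq') Pq' _ Sx.
apply: (Hmiss y') => //.
by rewrite -(computes_inj Hy Hy').
Qed.
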